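(* Let $A$ be an algebra and $L:A\to\mathbb{R}$ linear with $L(1)=1$. For any $S\in I$, let $K^{(S)}$ be a closed subset of $X(S)$ such that $\pi_{S,T}(K^{(T)})\subseteq K^{(S)}$ for any $T\in I$ containing $S$. (i) There exists an $X(A)$-representing measure $\mu$ for $L$ on the cylinder $\sigma$-algebra $\Sigma_I$ supported in each $\pi_S^{-1}(K^{(S)})$ with $S\in I$ if and only if for every $S\in I$ there exists a $K^{(S)}$-representing Radon measure $\mu_S$ for $L|_S$ such that $\{\mu_S:S\in I\}$ is an exact projective system and the corresponding exact projective system $\{\mu_T:T\in\Lambda\}$ is thick. (ii) There exists a $\left(\bigcap_{S\in I}\pi_S^{-1}(K^{(S)})\right)$-representing Radon measure $\nu$ for $L$ if and only if for every $S\in I$ there exists a $K^{(S)}$-representing Radon measure $\mu_S$ for $L|_S$ such that $\{\mu_S:S\in I\}$ fulfills Prokhorov's condition.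
   Context: All algebras are unital commutative real algebras, subalgebras contain the unit, and $X(A)\neq\emptyset$. For an algebra $S$, $X(S)$ is the set of unital $\mathbb{R}$-algebra homomorphisms $S\to\mathbb{R}$ (characters), with the weakest topology $\tau_{X(S)}$ such that for all $a\in S$ the function $\hat a:X(S)\to\mathbb{R}$, $\hat a(\alpha)=\alpha(a)$, is continuous; $\mathcal{B}_{X(S)}$ is its Borel $\sigma$-algebra. For subalgebras $S\subseteq T$ of $A$, $\pi_{S,T}:X(T)\to X(S)$ is the restriction map and $\pi_S:=\pi_{S,A}$. $I$ is the set of all finitely generated subalgebras of $A$ and $\Lambda$ the set of all countably generated subalgebras of $A$, both ordered by inclusion. The cylinder $\sigma$-algebra $\Sigma_I$ is the smallest $\sigma$-algebra on $X(A)$ such that all $\pi_S:X(A)\to (X(S),\mathcal{B}_{X(S)})$, $S\in I$, are measurable. Representing measures: for an algebra $B$, $\ell:B\to\mathbb{R}$ linear, a $\sigma$-algebra $\Sigma$ on $X(B)$ and $K\in\Sigma$, a $K$-representing measure for $\ell$ on $\Sigma$ is a measure $\nu$ on $\Sigma$ supported in $K$, i.e. $\nu(X(B)\setminus K)=0$, with $\ell(a)=\int_{X(B)}\alpha(a)\,d\nu(\alpha)$ for all $a\in B$. A Radon measure on a Hausdorff space is a Borel measure that is locally finite and inner regular with respect to compact sets (on all Borel sets). A $K$-representing Radon measure is a $K$-representing measure on $\mathcal{B}_{X(B)}$ that is Radon. Exact systems: a family $\{\mu_S:S\in I\}$ of measures $\mu_S$ on $\mathcal{B}_{X(S)}$ is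 an exact projective system if $(\pi_{S,T})_\#\mu_T=\mu_S$ (pushforward) for all $S\subseteq T$ in $I$; similarly for $\Lambda$. If $\{\mu_S:S\in I\}$ is an exact projective system of Radon probability measures, then for every $T\in\Lambda$ there is a unique Radon probability measure $\mu_T$ on $\mathcal{B}_{X(T)}$ with $(\pi_{S,T})_\#\mu_T=\mu_S$ for all $S\in I$ with $S\subseteq T$, and $\{\mu_T:T\in\Lambda\}$ is an exact projective system, called the corresponding one. It is called thick if for every $T\in\Lambda$, $\mu_T(M)=0$ for all $M\in\mathcal{B}_{X(T)}$ with $\pi_T(X(A))\cap M=\emptyset$. Prokhorov's condition for a family $\{\mu_S:S\in I\}$ of Radon probability measures on the $X(S)$: for every $\varepsilon>0$ there is a compact $C_\varepsilon\subset X(A)$ such that $\mu_S(\pi_S(C_\varepsilon))\ge 1-\varepsilon$ for all $S\in I$. *)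

(* Defs.v *)
From HB Require Import structures.
From mathcomp Require Import all_boot all_order all_algebra.
From mathcomp Require Import all_classical all_reals all_analysis.

Set Implicit Arguments.
Unset Strict Implicit.
Unset Printing Implicit Defensive.

Import Order.TTheory GRing.Theory Num.Theory.
Import numFieldNormedType.Exports.

Local Open Scope classical_set_scope.
Local Open Scope ring_scope.

(* A characterAlgType R is a unital commutative R-algebra that has at least one
   character.  Non-emptiness is part of the type because the measurable types
   of the library are pointed. *)
HB.mixin Record hasCharacter (R : realType) A of GRing.ComAlgebra R A := {
  character_inhabited : inhabited {lrmorphism A -> R | *%R}
}.

#[short(type="characterAlgType")]
HB.structure Definition CharacterAlg (R : realType) :=
  {A of GRing.ComAlgebra R A & hasCharacter R A}.

Section Characters.
Context {R : realType}.

Definition characters (B : comAlgType R) : Type := {lrmorphism B -> R | *%R}.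

Definition character_fun (B : comAlgType R) (x : characters B) :
  {lrmorphism B -> R | *%R} := x.
Coercion character_fun : characters >-> GRing.LRMorphism.type.

Definition gelfand (B : comAlgType R) (a : B) (x : characters B) : R := x a.

HB.instance Definition _ (B : comAlgType R) := gen_eqMixin (characters B).
HB.instance Definition _ (B : comAlgType R) := gen_choiceMixin (characters B).
HB.instance Definition _ (B : comAlgType R) := Topological.copy (characters B)
  (sup_topology (fun a : B => Topological.on (initial_topology (gelfand a)))).
HB.instance Definition _ (B : characterAlgType R) :=
  isPointed.Build (characters B) (inhabited_witness character_inhabited).

Definition pullback (B C : comAlgType R) (f : {lrmorphism B -> C})
  (x : characters C) : characters B := (x \o f : {lrmorphism B -> R | *%R}).

End Characters.

Section Subalgebras.
Context {R : realType}.

(* The library has no comAlgType structure on {x : A | x \in S}. *)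
Definition subalg (A : comAlgType R) (S : subalgClosed A) : Type :=
  {x : A | x \in S}.

HB.instance Definition _ (A : comAlgType R) (S : subalgClosed A) :=
  SubChoice.on (subalg S).
HB.instance Definition _ (A : comAlgType R) (S : subalgClosed A) :=
  [SubChoice_isSubAlgebra of subalg S by <:].
HB.instance Definition _ (A : comAlgType R) (S : subalgClosed A) :=
  [SubNzRing_isSubComNzRing of subalg S by <:].

Section Injection.
Variables (A : comAlgType R) (S : subalgClosed A).

(* [val] itself is only known to be linear and a ring morphism separately. *)
Definition subalg_val_fun (x : subalg S) : A := val x.

HB.instance Definition _ := GRing.isLinear.Build R _ _ _ subalg_val_fun
  (fun k => linearP (val : {linear subalg S -> A}) k).
HB.instance Definition _ := GRing.isMonoidMorphism.Build _ _ subalg_val_fun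
  (rmorphism_monoidP (val : {rmorphism subalg S -> A})).

Definition subalg_val : {lrmorphism subalg S -> A} := subalg_val_fun.

End Injection.

HB.instance Definition _ (A : characterAlgType R) (S : subalgClosed A) :=
  hasCharacter.Build R (subalg S)
    (let: inhabits x := @character_inhabited R A in
     inhabits (pullback (subalg_val S) x)).

Section Inclusion.
Variables (A : comAlgType R) (S T : subalgClosed A) (ST : {subset S <= T}).

Definition subalg_incl_fun (x : subalg S) : subalg T :=
  exist _ (val x) (ST (valP x)).

Fact subalg_incl_is_linear : linear subalg_incl_fun.
Proof.
move=> k x y; apply: val_inj.
apply: etrans (linearP (subalg_val S) k x y) _.
exact: (esym (linearP (subalg_val T) k (subalg_incl_fun x) (subalg_incl_fun y))).
Qed.

Fact subalg_incl_is_monoid_morphism : monoid_morphism subalg_incl_fun.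
Proof.
split=> [|x y]; apply: val_inj.
  exact: etrans (rmorph1 (subalg_val S)) (esym (rmorph1 (subalg_val T))).
apply: etrans (rmorphM (subalg_val S) x y) _.
exact: (esym (rmorphM (subalg_val T) (subalg_incl_fun x) (subalg_incl_fun y))).
Qed.

HB.instance Definition _ := GRing.isLinear.Build R _ _ _ subalg_incl_fun
  subalg_incl_is_linear.
HB.instance Definition _ := GRing.isMonoidMorphism.Build _ _ subalg_incl_fun
  subalg_incl_is_monoid_morphism.

Definition subalg_incl : {lrmorphism subalg S -> subalg T} := subalg_incl_fun.

End Inclusion.

Definition restr_sub (A : comAlgType R) (S T : subalgClosed A)
  (ST : {subset S <= T}) : characters (subalg T) -> characters (subalg S) :=
  pullback (subalg_incl ST).

Definition restr (A : comAlgType R) (S : subalgClosed A) :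
  characters A -> characters (subalg S) := pullback (subalg_val S).

Definition generated_by (A : comAlgType R) (F : set A) (S : subalgClosed A) :=
  F `<=` [set` S] /\
  forall U : subalgClosed A, F `<=` [set` U] -> {subset S <= U}.

Definition fin_generated (A : comAlgType R) (S : subalgClosed A) :=
  exists2 F : set A, finite_set F & generated_by F S.

Definition countably_generated (A : comAlgType R) (S : subalgClosed A) :=
  exists2 F : set A, countable F & generated_by F S.

End Subalgebras.

Arguments fin_generated {R A} S.
Arguments countably_generated {R A} S.

Definition borel (T : ptopologicalType) := g_sigma_algebraType (@open T).

Section Radon.
Context {R : realType} (T : ptopologicalType).
Local Open Scope ereal_scope.

Definition locally_finite_measure (mu : {measure set (borel T) -> \bar R}) :=
  forall x : T, exists U : set T, [/\ open U, U x & mu U < +oo].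

Definition inner_regular (mu : {measure set (borel T) -> \bar R}) :=
  forall B : set (borel T), measurable B ->
    mu B = ereal_sup [set mu C | C in [set C : set T | compact C /\ C `<=` B]].

Definition radon (mu : {measure set (borel T) -> \bar R}) :=
  locally_finite_measure mu /\ inner_regular mu.

End Radon.

Section Representing.
Context {R : realType}.

Definition supported_in d (T : measurableType d)
  (nu : {measure set T -> \bar R}) (K : set T) :=
  measurable K /\ nu (~` K) = 0%E.

(* The sigma-algebra on X(B) is the one generated by G. *)
Definition representing (B : characterAlgType R) (G : set (set (characters B)))
    (l : {scalar B}) (K : set (characters B))
    (nu : {measure set (g_sigma_algebraType G) -> \bar R}) :=
  supported_in nu K /\
  forall a : B, nu.-integrable setT (EFin \o gelfand a) /\
    (l a)%:E = (\int[nu]_x (gelfand a x)%:E)%E.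

Definition representing_radon (B : characterAlgType R) (l : {scalar B})
    (K : set (characters B))
    (nu : {measure set (borel (characters B)) -> \bar R}) :=
  representing l K nu /\ radon nu.

End Representing.

Section ProjectiveSystems.
Context {R : realType} (A : characterAlgType R).

Definition cylinders : set (set (characters A)) :=
  [set M | exists S : subalgClosed A, fin_generated S /\
    exists2 B : set (borel (characters (subalg S))),
      measurable B & M = restr S @^-1` B].

(* Families indexed by I or by Lambda are total functions on subalgebras; only
   their values on I, respectively on Lambda, are ever constrained. *)
Definition measure_family := forall S : subalgClosed A,
  {measure set (borel (characters (subalg S))) -> \bar R}.

Definition exact_system (P : subalgClosed A -> Prop) (mu : measure_family) :=
  forall (S T : subalgClosed A) (ST : {subset S <= T}), P S -> P T ->
  forall B : set (borel (characters (subalg S))), measurable B ->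
    pushforward (mu T) (restr_sub ST : borel _ -> borel _) B = mu S B.

Definition corresponding_system (mu muL : measure_family) :=
  [/\ forall T, countably_generated T -> radon (muL T) /\ muL T setT = 1%E,
      forall (S T : subalgClosed A) (ST : {subset S <= T}),
        fin_generated S -> countably_generated T ->
        forall B : set (borel (characters (subalg S))), measurable B ->
        pushforward (muL T) (restr_sub ST : borel _ -> borel _) B = mu S B
    & exact_system countably_generated muL].

Definition thick (muL : measure_family) :=
  forall T : subalgClosed A, countably_generated T ->
  forall M : set (borel (characters (subalg T))), measurable M ->
    range (restr T) `&` M = set0 -> muL T M = 0%E.

Definition prokhorov (mu : measure_family) :=
  forall e : R, 0 < e -> exists C : set (characters A), compact C /\
    forall S : subalgClosed A, fin_generated S ->
      ((1 - e)%:E <= mu S (restr S @` C))%E.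

End ProjectiveSystems.

Arguments cylinders {R} A _.

(* Main.v *)
Require Import Defs.
From HB Require Import structures.
From mathcomp Require Import all_boot all_order all_algebra.
From mathcomp Require Import all_classical all_reals all_analysis.
From mathcomp Require Import measurable_realfun lra.
Import Order.TTheory GRing.Theory Num.Theory.
Import numFieldNormedType.Exports.
Local Open Scope classical_set_scope.
Local Open Scope ring_scope.

Set Implicit Arguments.
Unset Strict Implicit.
Unset Printing Implicit Defensive.

(* (i) If T is countably generated, X(T) is second countable and every Borel
   probability measure on it is tight and therefore Radon; the marginals of a
   cylinder measure thus form a system as required, which is trivially thick.
   Conversely every set in the cylinder sigma-algebra is pi_T^{-1}(B) for some
   countably generated T, thickness makes mu(pi_T^{-1}(B)) := mu_T(B) well
   defined, and countably many sets live over one common T, whence countable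
   additivity.

   (ii) The marginals of a Radon representing measure satisfy Prokhorov's
   condition by inner regularity. Conversely the mu_S are not assumed to be
   compatible. Let m(E) be the limit, along an ultrafilter finer than the
   directed set I, of the outer mu_T-measure of pi_T(E). Then m is monotone,
   subadditive, additive along cylinder sets, and tight by Prokhorov's
   condition, so that G |-> sup {m(C) : C compact in G} on open sets G extends
   to a Radon probability measure nu with nu(G) <= m(G) for open cylinders G.
   This bound gives nu(complement of pi_S^{-1}(K_S)) = 0 and, by summing over
   level sets, that the nu-integral of a^2 is at most L(a^2) for every a.
   Applied to 1 + t a with t near 0 the latter forces the nu-integral of a to
   be L(a). *)

(** * Radon measures from tight set functions *)

(** Compactness as an induction principle: if [P C] failed, the sets [V] such that [P] holds for the
    part of [C] outside [V] would form a proper filter containing [C], and a cluster point of it in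
    [C] would contradict the local hypothesis. *)
Lemma compact_set_ind (X : topologicalType) (P : set X -> Prop) (C : set X) :
  compact C -> P set0 -> (forall A B, P A -> P B -> P (A `|` B)) ->
  (forall A B, A `<=` B -> P B -> P A) ->
  (forall x, C x -> exists2 U, nbhs x U & P U) -> P C.
Proof.
move=> cC P0 PU Psub Ploc; apply: contrapT => nPC.
pose F : set_system X := fun V => P (C `\` V).
have FF : ProperFilter F.
  split; first by rewrite /F setD0.
  split=> [|V W FV FW|V W VW]; first by rewrite /F setDT.
    by rewrite /F setDIr; exact: PU.
  by apply: Psub; exact: setDS.
have FC : F C by rewrite /F setDv.
have [x [Cx clx]] := cC F FF FC.
have [U nU PU'] := Ploc x Cx.
have FU : F (~` U) by rewrite /F setDE setCK; apply: Psub PU'; exact: subIsetr.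
by have [y [nUy Uy]] := clx _ _ FU nU.
Qed.

Section Splitting.
Context {R : numDomainType} {T : Type}.
Variable m : set T -> R.

(** Carathéodory's measurability condition, as an equality because [m] is an arbitrary set function
    here. *)
Definition splits (M : set T) := forall E, m E = m (E `&` M) + m (E `&` ~` M).

Lemma splitsC (M : set T) : splits M -> splits (~` M).
Proof. by move=> sM E; rewrite setCK addrC -sM. Qed.

Lemma splitsI (M N : set T) :
  splits M -> splits N -> splits (M `&` N).
Proof.
move=> sM sN E; have -> : E `&` (M `&` N) = E `&` M `&` N by rewrite setIA.
have EM : E `&` ~` (M `&` N) `&` M = E `&` M `&` ~` N.
  by apply/seteqP; split => x /=; tauto.
have EN : E `&` ~` (M `&` N) `&` ~` M = E `&` ~` M.
  by apply/seteqP; split => x /=; tauto.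
by rewrite (sM E) (sN (E `&` M)) (sM (E `&` ~` (M `&` N))) EM EN addrA.
Qed.

Lemma splitsU (M N : set T) : splits M -> splits N -> splits (M `|` N).
Proof.
move=> sM sN; rewrite -[M `|` N]setCK setCU.
by apply: splitsC; apply: splitsI; exact: splitsC.
Qed.

Lemma splits0 : m set0 = 0 -> splits set0.
Proof. by move=> m0 E; rewrite setI0 setC0 setIT m0 add0r. Qed.

End Splitting.

(** The set [M] and its exterior are disjoint open neighbourhoods of [C] and [D]; in addition [M]
    splits [m], so that separation also yields additivity. *)
Definition separated (R : numDomainType) (X : topologicalType) (m : set X -> R)
    (C D : set X) :=
  exists M, [/\ open M, C `<=` M, D `<=` (~` M)° & splits m M].

Section RadonExtension.
Context (R : realType) (X : ptopologicalType).
Variable m : set X -> R.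

Hypothesis hX : hausdorff_space X.
Hypothesis m0 : m set0 = 0.
Hypothesis m_mono : forall A B, A `<=` B -> m A <= m B.
Hypothesis mU : forall A B, m (A `|` B) <= m A + m B.
Hypothesis mT : m setT <= 1.
Hypothesis sep : forall C D, compact C -> compact D -> C `&` D = set0 ->
  separated m C D.
Hypothesis tight : forall e, 0 < e -> exists2 C, compact C & 1 - e <= m C.

Local Open Scope ereal_scope.

(* The construction of a Radon measure from a content on compact sets, with
   tightness of [m] in place of local compactness. *)
Let tau (G : set X) : \bar R :=
  ereal_sup [set (m C)%:E | C in [set C | compact C /\ C `<=` G]].
Let nu (E : set X) : \bar R :=
  ereal_inf [set tau G | G in [set G | open G /\ E `<=` G]].

Let tau_ge C G : compact C -> C `<=` G -> (m C)%:E <= tau G.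
Proof. by move=> cC CG; apply: ereal_sup_ubound; exists C. Qed.

Let tau_le G b : (forall C, compact C -> C `<=` G -> (m C)%:E <= b) ->
  tau G <= b.
Proof. by move=> H; apply: ge_ereal_sup => _ [C [cC CG] <-]; exact: H. Qed.

Let tau_ge0 G : 0 <= tau G.
Proof. by rewrite -[0]/(0%:E) -m0; apply: tau_ge => //; exact: compact0. Qed.

Let tau_le1 G : tau G <= 1.
Proof.
by apply: tau_le => C _ _; rewrite lee_fin; apply: le_trans mT; exact: m_mono.
Qed.

Let tau_mono G H : G `<=` H -> tau G <= tau H.
Proof.
by move=> GH; apply: tau_le => C cC CG; apply: tau_ge => //; exact: subset_trans GH.
Qed.

Let tau0 : tau set0 = 0.
Proof.
apply/eqP; rewrite eq_le tau_ge0 andbT; apply: tau_le => C _.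
by rewrite subset0 => ->; rewrite m0.
Qed.

Let nu_fin E : 0 <= nu E <= 1.
Proof.
apply/andP; split.
  by apply: le_ereal_inf_tmp => _ [G _ <-]; exact: tau_ge0.
apply: ge_ereal_inf; exists (tau setT); last exact: tau_le1.
by exists setT => //; split => //; exact: openT.
Qed.

Let nu_le G E : open G -> E `<=` G -> nu E <= tau G.
Proof. by move=> oG EG; apply: ereal_inf_lbound; exists G. Qed.

Let nu_ge E b : (forall G, open G -> E `<=` G -> b <= tau G) -> b <= nu E.
Proof. by move=> H; apply: le_ereal_inf_tmp => _ [G [oG EG] <-]; exact: H. Qed.

Let nu_open G : open G -> nu G = tau G.
Proof.
move=> oG; apply/eqP; rewrite eq_le nu_le//=.
by apply: nu_ge => H _; exact: tau_mono.
Qed.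

Let nu_mono E F : E `<=` F -> nu E <= nu F.
Proof.
by move=> EF; apply: nu_ge => G oG FG; apply: nu_le => //; exact: subset_trans FG.
Qed.

(** The parts of [C] outside [H] and outside [G] are disjoint compact sets. Removing from [C] the
    exterior of a separating [M], respectively [M] itself, leaves the two pieces. *)
Let compact_split (C G H : set X) : compact C -> open G -> open H -> C `<=` G `|` H ->
  exists C1 C2, [/\ compact C1, compact C2, C1 `<=` G, C2 `<=` H & C = C1 `|` C2].
Proof.
move=> cC oG oH CGH.
have cD V : open V -> compact (C `\` V).
  by move=> oV; rewrite setDE; apply: compact_closedI => //; exact: open_closedC.
have [|M [oM CM DM _]] := sep (cD _ oH) (cD _ oG).
  rewrite -subset0 => x [[Cx nHx] [_ nGx]].
  by case: (CGH x Cx).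
have oN : open (~` M)° by exact: open_interior.
exists (C `\` (~` M)°), (C `\` M); split; [exact: cD|exact: cD| | |].
- by move=> x [Cx nx]; apply: contrapT => nG; apply: nx; apply: DM.
- by move=> x [Cx nx]; apply: contrapT => nG; apply: nx; apply: CM.
- rewrite -setDIr; apply/seteqP; split => [x Cx|x []//]; split => //.
  by move=> [/interior_subset].
Qed.

Let tauU G H : open G -> open H -> tau (G `|` H) <= tau G + tau H.
Proof.
move=> oG oH; apply: tau_le => C cC /(compact_split cC oG oH).
move=> [C1 [C2 [c1 c2 CG CH ->]]].
apply: (@le_trans _ _ ((m C1)%:E + (m C2)%:E)); first by rewrite -EFinD lee_fin.
by apply: leeD; exact: tau_ge.
Qed.

Let tau_bigsetU (G : (set X)^nat) n : (forall k, open (G k)) ->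
  tau (\big[setU/set0]_(k < n) G k) <= \sum_(k < n) tau (G k).
Proof.
move=> oG; elim: n => [|n ih]; first by rewrite !big_ord0 tau0.
rewrite !big_ord_recr/=; apply: le_trans (tauU _ _) _ => //.
  by apply: big_ind => //; [exact: open0|exact: openU].
exact: leeD.
Qed.

Let tau_bigcup (G : (set X)^nat) : (forall k, open (G k)) ->
  tau (\bigcup_k G k) <= \sum_(k <oo) tau (G k).
Proof.
move=> oG; apply: tau_le => C cC CG.
have [n CGn] : exists n, C `<=` \big[setU/set0]_(k < n) G k.
  apply: (compact_set_ind (P := fun V => exists n, V `<=`
      \big[setU/set0]_(k < n) G k) cC).
  - by exists 0%N.
  - move=> A B [n An] [p Bp]; exists (maxn n p) => x [/An|/Bp].
      by apply: subset_bigsetU; exact: leq_maxl.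
    by apply: subset_bigsetU; exact: leq_maxr.
  - by move=> A B AB [n Bn]; exists n; exact: subset_trans Bn.
  - move=> x /CG[k _ Gkx]; exists (G k); first exact: open_nbhs_nbhs.
    by exists k.+1; rewrite big_ord_recr/=; right.
apply: (le_trans (tau_ge cC CGn)); apply: (le_trans (tau_bigsetU _ oG)).
rewrite -(big_mkord xpredT (fun k => tau (G k))).
exact: nneseries_lim_ge.
Qed.

Let nu_sigma_subadditive : sigma_subadditive nu.
Proof.
move=> F; apply/lee_addgt0Pr => e e0.
apply: le_trans (epsilon_trick xpredT _ (ltW e0)); last first.
  by move=> n; case/andP: (nu_fin (F n)).
have /choice[G HG] : forall n, exists G, [/\ open G, F n `<=` G &
    tau G <= nu (F n) + (e / (2 ^ n.+1)%:R)%:E].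
  move=> n; have [| |x [G [oG FG] <-] Gx] := @lb_ereal_inf_adherent R
      [set tau G | G in [set G | open G /\ F n `<=` G]] (e / (2 ^ n.+1)%:R).
  - by rewrite divr_gt0// ltr0n expn_gt0.
  - have /andP[n0 n1] := nu_fin (F n); rewrite ge0_fin_numE//.
    by apply: le_lt_trans n1 _; exact: ltry.
  - by exists G; split => //; exact: ltW.
apply: (@le_trans _ _ (tau (\bigcup_k G k))).
  apply: nu_le; first by apply: bigcup_open => k _; have [] := HG k.
  by apply: subset_bigcup => k _; have [] := HG k.
apply: le_trans (tau_bigcup _) _; first by move=> k; have [] := HG k.
by apply: lee_nneseries => // k _; have [] := HG k.
Qed.

Let nu0 : nu set0 = 0.
Proof. by rewrite nu_open ?tau0//; exact: open0. Qed.

Let nu_ge0 E : 0 <= nu E.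
Proof. by case/andP: (nu_fin E). Qed.

#[local] HB.instance Definition _ :=
  isOuterMeasure.Build R X nu nu0 nu_ge0 nu_mono nu_sigma_subadditive.

Let m_disjoint C D : compact C -> compact D -> C `&` D = set0 ->
  m (C `|` D) = (m C + m D)%R.
Proof.
move=> cC cD CD; have [M [oM CM DM sM]] := sep cC cD CD.
have {}DM : D `<=` ~` M by apply: subset_trans DM _; exact: interior_subset.
rewrite (sM (C `|` D)); congr (m _ + m _)%R; apply/seteqP; split=> x.
- by move=> [[//|/DM]].
- by move=> Cx; split; [left|exact: CM].
- by move=> [[/CM|//]].
- by move=> Dx; split; [right|exact: DM].
Qed.

(** An open [H] containing [E] is exhausted from inside twice: by a compact [C] in the intersection
    of [H] and [G], then by a compact [D] in [H] minus [C], an open set that contains [E] minus [G].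
    Additivity on disjoint compact sets bounds [m C + m D] by [tau H]. *)
Let nu_caratheodory_open G : open G -> nu.-caratheodory G.
Proof.
move=> oG; apply: le_caratheodory_measurable => E.
apply: nu_ge => H oH EH.
have fnu : nu (E `&` ~` G) \is a fin_num.
  have /andP[n0 n1] := nu_fin (E `&` ~` G); rewrite ge0_fin_numE//.
  by apply: le_lt_trans n1 _; exact: ltry.
apply: (@le_trans _ _ (tau (H `&` G) + nu (E `&` ~` G))).
  by rewrite leeD2r// nu_le//; [exact: openI|exact: setSI].
rewrite -leeBrDr//; apply: tau_le => C cC CHG; rewrite leeBrDr//.
have clC : closed C by exact: compact_closed.
apply: (@le_trans _ _ ((m C)%:E + tau (H `\` C))).
  rewrite leeD2l// nu_le//; first by apply: openI => //; exact: closed_openC.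
  by move=> x [Ex nGx]; split; [exact: EH|move=> /CHG[]].
rewrite addeC -leeBrDr//; apply: tau_le => D cD DHC; rewrite leeBrDr// -EFinD addrC.
rewrite -m_disjoint//; last by rewrite -subset0 => x [Cx /DHC[]].
by apply: tau_ge; [exact: compactU|move=> x [/CHG[]|/DHC[]]].
Qed.

Let borel_caratheodory (B : set (borel X)) : measurable B -> nu.-caratheodory B.
Proof.
move=> mB; pose S := [set A : set X | (nu : {outer_measure set X -> \bar R}).-caratheodory A].
suff : <<s @open X >> `<=` S by apply.
apply: smallest_sub; last by move=> G /nu_caratheodory_open.
split; rewrite /S/=.
- exact: caratheodory_measurable_set0.
- by move=> A mA; rewrite setTD; exact: caratheodory_measurable_setC.
- by move=> A mA; exact: caratheodory_measurable_bigcup.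
Qed.

(** The same function on the type that carries the Borel sigma-algebra, where it becomes a
    measure. *)
Let nuB (B : set (borel X)) := nu B.
Let nuB0 : nuB set0 = 0. Proof. exact: nu0. Qed.
Let nuB_ge0 B : 0 <= nuB B. Proof. exact: nu_ge0. Qed.
Let nuB_sigma_additive : semi_sigma_additive nuB.
Proof.
move=> A mA tA mUA.
apply: (@caratheodory_measure_sigma_additive R X
  (nu : {outer_measure set X -> \bar R}) A) => //.
- by move=> i; exact: borel_caratheodory.
- exact: borel_caratheodory.
Qed.

#[local] HB.instance Definition _ :=
  isMeasure.Build _ _ _ nuB nuB0 nuB_ge0 nuB_sigma_additive.

(** By tightness almost all of the mass lies on a compact set [C]. This gives total mass 1, and both
    the upper bound on [G] and inner regularity are read off from [C] minus an open set. *)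
Lemma radon_extension : exists nu : {measure set (borel X) -> \bar R},
  [/\ radon nu, nu setT = 1 &
    forall G, open G -> splits m G -> nu G <= (m G)%:E].
Proof.
have mC_nu C : compact C -> (m C)%:E <= nu C.
  by move=> cC; apply: nu_ge => G _; exact: tau_ge.
have nuT : nu setT = 1.
  apply/eqP; rewrite eq_le; have /andP[_ ->] := nu_fin setT => /=.
  apply/lee_addgt0Pr => e e0; have [C cC mC] := tight e0.
  rewrite -leeBlDr//; apply: (@le_trans _ _ (m C)%:E).
    by rewrite -EFinB lee_fin.
  by apply: le_trans (mC_nu _ cC) _; exact: nu_mono.
have nuE E : nu E = (fine (nu E))%:E.
  have /andP[n0 n1] := nu_fin E; rewrite fineK// ge0_fin_numE//.
  by apply: le_lt_trans n1 _; exact: ltry.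
exists nuB; split => //; last first.
  (* Since [G] splits [m], [1 - e <= m C] is at most [m G] plus the value of [m] on the compact set
     [C] minus [G]; the latter is at most the [nu]-mass of the complement of [G], that is
     [1 - nu G]. *)
  move=> G oG sG; apply/lee_addgt0Pr => e e0.
  have [C cC mC] := tight e0.
  have cCG : compact (C `\` G).
    by rewrite setDE; apply: compact_closedI => //; exact: open_closedC.
  have h1 : nu G + nu (~` G) = 1 by rewrite -nuT (nu_caratheodory_open oG setT) !setTI.
  have h2 := le_trans (mC_nu _ cCG) (nu_mono (@subIsetr _ C (~` G))).
  have h3 := m_mono (@subIsetr _ C G).
  change (nu G <= (m G)%:E + e%:E).
  have h4 := sG C.
  move: h1 h2; rewrite (nuE G) (nuE (~` G)) -!EFinD !lee_fin setDE => -[] h1 h2.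
  lra.
split.
  by move=> x; exists setT; split => //; [exact: openT|rewrite [X in X < _]nuT ltry].
move=> B mB; apply/eqP; rewrite eq_le; apply/andP; split; last first.
  by apply: ge_ereal_sup => _ [C [_ CB] <-]; exact: nu_mono.
apply/lee_addgt0Pr => e e0.
have h0 : (0 < e / 2)%R by rewrite divr_gt0.
have [C cC mC] := tight h0.
have fB : nu (~` B) \is a fin_num by rewrite nuE.
(* An open [G] contains the complement of [B] and exceeds its mass by less than [e / 2]. Then [C]
   minus [G] is a compact part of [B] that loses at most [e], one half through [C] and one half
   through [G]. *)
have [_ [G [oG BG] <-]] := @lb_ereal_inf_adherent R
  [set tau G | G in [set G | open G /\ ~` B `<=` G]] (e / 2) h0 fB.
rewrite -/(nu (~` B)) -nu_open// => GB.
have cCG : compact (C `\` G).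
  by rewrite setDE; apply: compact_closedI => //; exact: open_closedC.
have CGB : C `\` G `<=` B.
  by move=> x [_ nGx]; apply: contrapT => /BG.
apply: (@le_trans _ _ (nu (C `\` G) + e%:E)); last first.
  by rewrite leeD2r//; apply: ereal_sup_ubound; exists (C `\` G).
change (nu B <= nu (C `\` G) + e%:E).
have h1 : nu B + nu (~` B) = 1.
  by rewrite -nuT (borel_caratheodory mB setT) !setTI.
have h2 : nu C <= nu (C `\` G) + nu G.
  apply: le_trans (outer_measureU2 (nu : {outer_measure set X -> \bar R}) _ _).
  by apply: nu_mono => x Cx; have [Gx|nGx] := pselect (G x); [right|left].
have h3 := mC_nu _ cC.
move: h1 h2 h3 GB; rewrite (nuE B) (nuE (~` B)) (nuE C) (nuE G) (nuE (C `\` G)).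
rewrite -!EFinD !lee_fin lte_fin => -[] h1 h2 h3 h4; lra.
Qed.

End RadonExtension.

(** * The space of characters *)

(** The compact interval provides a cluster point, which along an ultrafilter is a limit. *)
Lemma ultra_bounded_cvg (R : realType) (T : Type) (F : set_system T)
    (f : T -> R) (a b : R) :
  UltraFilter F -> F [set x | a <= f x <= b] -> cvg (f @ F).
Proof.
move=> UF Fab; have PF : ProperFilter F := @ultra_proper _ _ UF.
have Gab : (f @ F) `[a, b]%classic.
  suff -> : (f @ F) `[a, b]%classic = F [set x | a <= f x <= b] by [].
  by congr F; apply/funext => x; rewrite /= in_itv.
have [l [_ cl]] := @segment_compact R a b (f @ F) _ Gab.
apply/cvg_ex; exists l => V nV.
have [//|FV] := in_ultra_setVsetC (f @^-1` V) UF.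
by have [y [nVy Vy]] := cl (~` V) V FV nV.
Qed.

Section CharacterSpace.
Context {R : realType}.

Lemma character_ext (B : comAlgType R) (x y : characters B) :
  (forall b, x b = y b) -> x = y.
Proof.
case: x y => [f [[f1] [f2] [f3]]] [g [[g1] [g2] [g3]]] /= /funext fg.
case: g / fg g1 g2 g3 => g1 g2 g3.
by rewrite (Prop_irrelevance f1 g1) (Prop_irrelevance f2 g2) (Prop_irrelevance f3 g3).
Qed.

Lemma gelfand_continuous (B : comAlgType R) (b : B) :
  continuous (gelfand b : characters B -> R).
Proof.
move=> x.
have /cvg_sup/(_ b) xb : nbhs x --> x by exact: cvg_id.
exact: (cvg_comp _ _ xb (@initial_continuous _ _ (gelfand b) x)).
Qed.

Lemma characters_cvg (B : comAlgType R) (F : set_system (characters B))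
    {FF : Filter F} (x : characters B) :
  (forall b, gelfand b y @[y --> F] --> gelfand b x) -> F --> x.
Proof.
move=> H; apply/cvg_sup => b A.
move=> [_ [[V oV <-] Vx VA]].
apply: filterS VA _; apply: (H b V); exact: open_nbhs_nbhs.
Qed.

Lemma gelfand_separates (B : comAlgType R) (x y : characters B) :
  x != y -> exists b t, gelfand b x < t < gelfand b y.
Proof.
move=> /eqP xy.
have [b xyb] : exists b, x b <> y b.
  by apply: contrapT => H; apply: xy; apply: character_ext => b;
     apply: contrapT => ?; apply: H; exists b.
have mid (c d : R) : c < d -> c < (c + d) / 2 < d.
  by move=> cd; apply/andP; split; lra.
have [/mid lt|/mid lt|//] := ltgtP (x b) (y b).
  by exists b, ((x b + y b) / 2).
(* Negating [b] reverses the inequality and restores the required orientation. *)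
exists (- b), ((x (- b) + y (- b)) / 2).
have xN (z : characters B) : z (- b) = - z b by rewrite rmorphN.
by apply: mid; rewrite /gelfand !xN ltrN2; case/andP: lt => /lt_trans; apply.
Qed.

Lemma open_gelfand_lt (B : comAlgType R) (b : B) t :
  open [set x : characters B | gelfand b x < t].
Proof.
apply: (open_comp (f := gelfand b) (D := [set r | r < t])); last exact: open_lt.
by move=> x _; exact: gelfand_continuous.
Qed.

Lemma open_gelfand_gt (B : comAlgType R) (b : B) t :
  open [set x : characters B | t < gelfand b x].
Proof.
apply: (open_comp (f := gelfand b) (D := [set r | t < r])); last exact: open_gt.
by move=> x _; exact: gelfand_continuous.
Qed.

Lemma characters_hausdorff (B : characterAlgType R) :
  hausdorff_space (characters B).
Proof.
rewrite open_hausdorff => x y /gelfand_separates[b [t /andP[xt ty]]].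
exists ([set z | gelfand b z < t], [set z | t < gelfand b z]); first by rewrite !inE.
split; [exact: open_gelfand_lt|exact: open_gelfand_gt|apply/eqP].
by rewrite -subset0 => z [/= zt /(lt_trans zt)]; rewrite ltxx.
Qed.

Lemma pullback_continuous (B C : comAlgType R) (f : {lrmorphism B -> C}) :
  continuous (pullback f : characters C -> characters B).
Proof.
move=> x; apply: (@characters_cvg _ _ (fmap_filter (pullback f) (nbhs_filter x))) => b.
exact: (@gelfand_continuous _ (f b) x).
Qed.

(** Along an ultrafilter containing [Z] every [b], being bounded on [Z], has a limit. These limits
    are linear and multiplicative in [b], hence form a character, which lies in [Z] because [Z] is
    closed. *)
Lemma compact_bounded_characters (B : comAlgType R) (Z : set (characters B)) :
  closed Z -> (forall b, exists M, forall x, Z x -> `|gelfand b x| <= M) ->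
  compact Z.
Proof.
move=> clZ bZ; rewrite compact_ultra => F UF FZ.
have PF : ProperFilter F := @ultra_proper _ _ UF.
have cvF b : gelfand b @ F --> lim (gelfand b @ F).
  have [M HM] := bZ b; apply: (@ultra_bounded_cvg _ _ _ _ (- M) M UF).
  by apply: filterS FZ => x /HM; rewrite ler_norml.
pose chi b : R := lim (gelfand b @ F).
have chiE b l : gelfand b @ F --> l -> chi b = l by exact: cvg_lim.
have chi_lin : linear_for *%R chi.
  move=> k a b; apply: chiE.
  rewrite (_ : gelfand _ = (fun x => k * gelfand a x + gelfand b x)); last first.
    by apply/funext => x; rewrite /gelfand linearP.
  by apply: cvgD => //; apply: cvgMr.
have chi_mul : monoid_morphism chi.
  split.
    apply: chiE; rewrite (_ : gelfand _ = cst 1); first exact: cvg_cst.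
    by apply/funext => x; rewrite /gelfand rmorph1.
  move=> a b; apply: chiE.
  rewrite (_ : gelfand _ = (fun x => gelfand a x * gelfand b x)); last first.
    by apply/funext => x; rewrite /gelfand rmorphM.
  exact: cvgM.
pose chiL := GRing.isLinear.Build R B R *%R chi chi_lin.
pose chiM := GRing.isMonoidMorphism.Build B R chi chi_mul.
pose X : {lrmorphism B -> R | *%R} := HB.pack chi chiL chiM.
have FX : F --> (X : characters B).
  by apply: characters_cvg => b; exact: cvF.
by exists X; split => //; exact: (@closed_cvg _ _ F PF id Z clZ FZ X FX).
Qed.

(** Two points are separated by a half-space [gelfand b x < t]. A finite intersection of half-spaces
    separates a point from [D], then a finite union of those separates [C] from [D]; both operations
    preserve [splits]. *)
Lemma characters_separated (B : comAlgType R) (m : set (characters B) -> R)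
    (C D : set (characters B)) :
  m set0 = 0 -> (forall b t, splits m [set x | gelfand b x < t]) ->
  compact C -> compact D -> C `&` D = set0 -> separated m C D.
Proof.
move=> m0 sm cC cD CD.
have s0 : splits m set0 by exact: splits0.
have sT : splits m setT by rewrite -setC0; exact: splitsC.
apply: (compact_set_ind (P := fun U => separated m U D) cC).
- by exists set0; split; [exact: open0|exact: sub0set|rewrite setC0 interiorT|].
- move=> U V [M [oM UM DM sM]] [N [oN VN DN sN]]; exists (M `|` N); split.
  + exact: openU.
  + exact: setUSS.
  + by rewrite setCU interiorI => z Dz; split; [exact: DM|exact: DN].
  + exact: splitsU.
- by move=> U V UV [M [oM VM DM sM]]; exists M; split => //; exact: subset_trans VM.
move=> x Cx.
have [U [nU [M [oM UM DM sM]]]] : exists U, nbhs x U /\ separated m U D.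
  apply: (compact_set_ind (P := fun V => exists U, nbhs x U /\ separated m U V) cD).
  - exists setT; split; first exact: filterT.
    by exists setT; split; [exact: openT| |exact: sub0set|].
  - move=> V W [U [nU [M [oM UM VM sM]]]] [U' [nU' [N [oN UN WN sN]]]].
    exists (U `&` U'); split; first exact: filterI.
    exists (M `&` N); split.
    + exact: openI.
    + exact: setISS.
    + rewrite setCI => z [/VM|/WN].
        by apply: interiorS; exact: subsetUl.
      by apply: interiorS; exact: subsetUr.
    + exact: splitsI.
  - move=> V W VW [U [nU [M [oM UM WM sM]]]]; exists U; split => //.
    by exists M; split => //; exact: subset_trans WM.
  - move=> y Dy; have /gelfand_separates[b [t /andP[xt ty]]] : x != y.
      by apply/eqP => xy; rewrite -[False]/(set0 x) -CD; split => //; rewrite xy.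
    exists [set z | t < gelfand b z].
      by apply: open_nbhs_nbhs; split => //; exact: open_gelfand_gt.
    have nx : nbhs x [set z | gelfand b z < t].
      by apply: open_nbhs_nbhs; split => //; exact: open_gelfand_lt.
    exists [set z | gelfand b z < t]; split=> //.
    exists [set z | gelfand b z < t]; split => //.
      exact: open_gelfand_lt.
    rewrite -open_subsetE; last exact: open_gelfand_gt.
    by move=> z /= tz zt; move: (lt_trans zt tz); rewrite ltxx.
by exists U => //; exists M.
Qed.

End CharacterSpace.

(** * Subalgebras and second countability *)

Section BorelMeasurability.

Lemma borel_open (T : ptopologicalType) (G : set T) :
  open G -> measurable (G : set (borel T)).
Proof. exact: sub_sigma_algebra. Qed.

Lemma borel_closed (T : ptopologicalType) (F : set T) :
  closed F -> measurable (F : set (borel T)).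
Proof.
by move=> cF; rewrite -[F]setCK; apply: measurableC; apply: borel_open; exact: closed_openC.
Qed.

Lemma measurable_fun_borel d (X : measurableType d) (T : ptopologicalType)
    (f : X -> borel T) :
  (forall G : set T, open G -> measurable (f @^-1` G)) ->
  measurable_fun setT f.
Proof.
move=> H; apply: (@measurability _ _ _ _ setT f (@open T)) => // _ [G oG <-].
by rewrite setTI; exact: H.
Qed.

Lemma borel_continuous (S T : ptopologicalType) (f : S -> T) :
  continuous f -> measurable_fun setT (f : borel S -> borel T).
Proof.
move=> cf; apply: measurable_fun_borel => G oG; apply: borel_open.
by apply: open_comp oG => x _; exact: cf.
Qed.

Lemma measurable_funR d (X : measurableType d) (R : realType) (f : X -> R) :
  (forall t, measurable [set x | t < f x]) -> measurable_fun setT f.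
Proof.
move=> H; apply: (measurability _ (RGenOInfty.measurableE R)) => _ [_ [t ->] <-].
rewrite setTI (_ : _ @^-1` _ = [set x | t < f x])//.
by apply/seteqP; split => x /=; rewrite in_itv/= andbT.
Qed.

Lemma gelfand_measurable (R : realType) (B : characterAlgType R) (b : B) :
  measurable_fun setT (gelfand b : borel (characters B) -> R).
Proof.
by apply: measurable_funR => t; apply: borel_open; exact: open_gelfand_gt.
Qed.

End BorelMeasurability.

Section Subalgebras.
Context {R : realType}.

Lemma subalg_of_pred (A : comAlgType R) (Q : A -> Prop) :
  Q 1 -> (forall k x y, Q x -> Q y -> Q (k *: x + y)) ->
  (forall x y, Q x -> Q y -> Q (x * y)) ->
  exists U : subalgClosed A, forall a, (a \in U) = `[< Q a >].
Proof.
move=> Q1 Ql QM; pose q : A -> bool := fun a => `[< Q a >].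
have cq : GRing.subalg_closed q.
  split; first exact/asboolP.
    by move=> k x y /asboolP Qx /asboolP Qy; apply/asboolP; exact: Ql.
  by move=> x y /asboolP Qx /asboolP Qy; apply/asboolP; exact: QM.
pose U0 := GRing.isSubalgClosed.Build R A q (GRing.subalg_closed_semi cq).
pose U : subalgClosed A := HB.pack q U0.
by exists U.
Qed.

(** The intersection of all subalgebras containing [F] is taken. *)
Lemma generated_by_exists (A : comAlgType R) (F : set A) :
  exists S : subalgClosed A, generated_by F S.
Proof.
have [| | |S HS] := @subalg_of_pred A
  (fun a => forall U : subalgClosed A, F `<=` [set` U] -> a \in U).
- by move=> U _; exact: rpred1.
- move=> k x y Hx Hy U FU.
  by apply: rpredD; [apply: rpredZ|]; [exact: Hx|exact: Hy].
- by move=> x y Hx Hy U FU; apply: rpredM; [exact: Hx|exact: Hy].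
exists S; split; first by move=> a Fa /=; rewrite HS; apply/asboolP => U; exact.
by move=> U FU a; rewrite HS => /asboolP; exact.
Qed.

Lemma fin_generated_countably (A : comAlgType R) (S : subalgClosed A) :
  fin_generated S -> countably_generated S.
Proof. by move=> [F fF FS]; exists F => //; exact: finite_set_countable. Qed.

Lemma fin_generated_mem (A : comAlgType R) (a : A) :
  exists2 S : subalgClosed A, fin_generated S & a \in S.
Proof.
have [S gS] := generated_by_exists [set a].
by exists S; [exists [set a] => //; exact: finite_set1|exact: gS.1].
Qed.

Lemma fin_generated_join (A : comAlgType R) (S T : subalgClosed A) :
  fin_generated S -> fin_generated T -> exists U : subalgClosed A,
  [/\ fin_generated U, {subset S <= U} & {subset T <= U}].
Proof.
move=> [F fF [FS minS]] [G fG [GT minT]].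
have [U [FU minU]] := generated_by_exists (F `|` G).
exists U; split; first by exists (F `|` G) => //; rewrite finite_setU.
  by apply: minS => a Fa; apply: FU; left.
by apply: minT => a Ga; apply: FU; right.
Qed.

(** Countable directedness: a countable union of countable sets of generators is countable. It
    allows countably many cylinder sets to be moved to one base. *)
Lemma countably_generated_join (A : comAlgType R) (S : nat -> subalgClosed A) :
  (forall n, countably_generated (S n)) -> exists2 T : subalgClosed A,
  countably_generated T & forall n, {subset S n <= T}.
Proof.
move=> cS; have /choice[F HF] : forall n, exists F : set A,
    countable F /\ generated_by F (S n).
  by move=> n; have [F cF FS] := cS n; exists F.
have [T [FT minT]] := generated_by_exists (\bigcup_n F n).
exists T.
  by exists (\bigcup_n F n) => //; apply: bigcup_countable => // n _; have [] := HF n.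
move=> n; have [_ [_ minS]] := HF n.
by apply: minS => a Fa; apply: FT; exists n.
Qed.

Lemma countably_generated_join2 (A : comAlgType R) (S T : subalgClosed A) :
  countably_generated S -> countably_generated T -> exists U : subalgClosed A,
  [/\ countably_generated U, {subset S <= U} & {subset T <= U}].
Proof.
move=> cS cT; have [n|U cU SU] := @countably_generated_join A
  (fun n => if n is 0%N then S else T); first by case: n.
by exists U; split => //; [exact: (SU 0%N)|exact: (SU 1%N)].
Qed.

Lemma restr_subK (A : comAlgType R) (S T : subalgClosed A)
  (ST : {subset S <= T}) (x : characters A) : restr_sub ST (restr T x) = restr S x.
Proof. exact: character_ext. Qed.

Lemma restr_sub_preimage (A : comAlgType R) (S T : subalgClosed A)
    (ST : {subset S <= T}) (B : set (characters (subalg S))) :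
  restr T @^-1` (restr_sub ST @^-1` B) = restr S @^-1` B.
Proof. by apply/seteqP; split => x; rewrite /preimage/= restr_subK. Qed.

Lemma restr_sub_id (A : comAlgType R) (S : subalgClosed A)
    (SS : {subset S <= S}) (x : characters (subalg S)) : restr_sub SS x = x.
Proof. by apply: character_ext => b /=; congr (x _); exact: val_inj. Qed.

Lemma restr_continuous (A : comAlgType R) (S : subalgClosed A) :
  continuous (restr S : characters A -> _).
Proof. exact: pullback_continuous. Qed.

Lemma restr_sub_continuous (A : comAlgType R) (S T : subalgClosed A)
  (ST : {subset S <= T}) : continuous (restr_sub ST).
Proof. exact: pullback_continuous. Qed.

End Subalgebras.

Section SeqGenerated.
Context {R : realType}.

(** Generation is phrased as an induction principle, the form in which convergence and boundedness
    propagate from the generators to the whole algebra. *)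
Definition seq_generates (B : comAlgType R) (e : nat -> B) :=
  forall P : B -> Prop, P 1 ->
    (forall k x y, P x -> P y -> P (k *: x + y)) ->
    (forall x y, P x -> P y -> P (x * y)) ->
    (forall n, P (e n)) -> forall b, P b.

Lemma countably_generated_seq (A : comAlgType R) (S : subalgClosed A) :
  countably_generated S -> exists e : nat -> subalg S, seq_generates e.
Proof.
move=> [F /countable_injP[f fI] [FS minS]].
(* The generators are enumerated through the injection [f] of [F] into the natural numbers; a number
   that is not attained gets the value [1]. *)
have /choice[e He] : forall n, exists b : subalg S, forall a, F a -> f a = n -> val b = a.
  move=> n; have [[a [Fa fan]]|nex] := pselect (exists a, F a /\ f a = n).
    have aS : a \in S by exact: FS.
    exists (exist _ a aS) => a' Fa' fa'; apply: fI; rewrite ?inE//.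
    by rewrite fan fa'.
  by exists 1 => a Fa fan; exfalso; apply: nex; exists a.
exists e => P P1 Pl PM Pe b.
(* The images in [A] of the elements satisfying [P] form a subalgebra containing [F], hence
   containing [S] by minimality. *)
have [| | |U HU] := @subalg_of_pred R A (fun a => exists2 b : subalg S, val b = a & P b).
- by exists 1.
- by move=> k _ _ [x <- Px] [y <- Py]; exists (k *: x + y) => //; exact: Pl.
- by move=> _ _ [x <- Px] [y <- Py]; exists (x * y) => //; exact: PM.
have : val b \in U.
  apply: minS (valP b) => a Fa /=; rewrite HU; apply/asboolP.
  by exists (e (f a)) => //; exact: He.
by rewrite HU => /asboolP[c /val_inj <-].
Qed.

Definition box (B : comAlgType R) (e : nat -> B) (l : seq (nat * rat * nat)) :=
  [set x : characters B | forall p, p \in l ->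
    `|gelfand (e p.1.1) x - ratr p.1.2| <= p.2.+1%:R^-1].

Lemma box_cat (B : comAlgType R) (e : nat -> B) l l' :
  box e (l ++ l') = box e l `&` box e l'.
Proof.
apply/seteqP; split => x.
  by move=> H; split => p pl; apply: H; rewrite mem_cat pl ?orbT.
by move=> [H H'] p; rewrite mem_cat => /orP[/H|/H'].
Qed.

(** The supersets of boxes around [x] form a filter. Its convergence to [x] may be tested on each
    [b], and passes from the generators to all [b] because limits respect sums and products. *)
Lemma nbhs_box (B : comAlgType R) (e : nat -> B) (x : characters B) V :
  seq_generates e -> nbhs x V -> exists2 l, box e l x & box e l `<=` V.
Proof.
move=> ge nV; pose F : set_system (characters B) :=
  fun V => exists2 l, box e l x & box e l `<=` V.
have FF : Filter F.
  split.
  - by exists [::].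
  - move=> U W [l lx lU] [l' lx' lW]; exists (l ++ l'); rewrite box_cat//.
    exact: setISS.
  - by move=> U W UW [l lx lU]; exists l => //; exact: subset_trans UW.
suff : F --> x by exact.
apply: characters_cvg; apply: ge.
- rewrite (_ : gelfand 1 = cst 1); first exact: cvg_cst.
  by apply/funext => y; rewrite /gelfand rmorph1.
- move=> k a b ca cb; rewrite (_ : gelfand (k *: a + b) =
     (fun x => k * gelfand a x + gelfand b x)); last first.
    by apply/funext => y; rewrite /gelfand linearP.
  by apply: cvgD => //; apply: cvgMr.
- move=> a b ca cb; rewrite (_ : gelfand (a * b) =
     (fun x => gelfand a x * gelfand b x)); last first.
    by apply/funext => y; rewrite /gelfand rmorphM.
  exact: cvgM.
move=> k; apply/cvgrPdist_le => eps eps0.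
(* The radius [r] is below [eps / 2] and the rational centre [q] is within [r] of the value at [x],
   so values at [x] and at a point of the box differ by at most [2 r]. *)
have [n] := ltr_add_invr (divr_gt0 eps0 (@ltr0n R 2)).
rewrite add0r => n2.
have n0 : (0 : R) < n.+1%:R^-1 by rewrite invr_gt0.
set r : R := n.+1%:R^-1 in n2 n0.
have [|q] := @rat_in_itvoo R (gelfand (e k) x - r) (gelfand (e k) x + r).
  by lra.
rewrite in_itv/= => /andP[q1 q2].
exists [:: (k, q, n)].
  by move=> p; rewrite inE => /eqP -> /=; rewrite -/r ler_norml; apply/andP; split; lra.
move=> y /(_ (k, q, n)); rewrite inE eqxx /= => /(_ isT).
rewrite -/r !ler_norml => /andP[y1 y2]; apply/andP; split; lra.
Qed.

(* The closed boxes [box e l] are countably many and form a network, so [Q] only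
   has to be checked on strips, finite intersections and the two trivial sets. *)
Lemma open_bigcup_box (B : comAlgType R) (e : nat -> B)
    (Q : set (characters B) -> Prop) :
  seq_generates e -> Q set0 -> Q setT ->
  (forall b q r, Q [set x | `|gelfand b x - q| <= r]) ->
  (forall U V, Q U -> Q V -> Q (U `&` V)) ->
  forall G, open G -> exists2 F : nat -> set (characters B),
    (forall n, Q (F n)) & G = \bigcup_n F n.
Proof.
move=> ge Q0 QT Qstrip QI G oG.
have Qbox l : Q (box e l).
  elim: l => [|p l ih].
    by rewrite (_ : box e [::] = setT)//; apply/seteqP; split.
  rewrite -cat1s box_cat; apply: QI => //.
  rewrite (_ : box _ _ = [set x | `|gelfand (e p.1.1) x - ratr p.1.2| <= p.2.+1%:R^-1]).
    exact: Qstrip.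
  apply/seteqP; split => x /=; first by apply; rewrite inE.
  by move=> H p'; rewrite inE => /eqP ->.
(* Numbers that do not encode a box inside [G] contribute the empty set. *)
exists (fun n => if unpickle n is Some l then
    if `[< box e l `<=` G >] then box e l else set0 else set0).
  by move=> n; case: unpickle => // l; case: asboolP.
apply/seteqP; split => [x Gx|x [n _]].
  have [l lx lG] := nbhs_box ge (open_nbhs_nbhs (conj oG Gx)).
  by exists (pickle l) => //; rewrite pickleK; case: asboolP.
by case: unpickle => // l; case: asboolP => // + /[dup] => /[apply].
Qed.

End SeqGenerated.

(** * Radon measures on spaces of characters *)

Lemma measure_setC d (T : measurableType d) (R : realType)
    (mu : {measure set T -> \bar R}) (A : set T) :
  measurable A -> (mu A + mu (~` A) = mu setT)%E.
Proof. by move=> mA; rewrite (measureDI mu measurableT mA) setTD setTI addeC. Qed.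

Lemma fin_num_measure1 d (T : measurableType d) (R : realType)
    (mu : {measure set T -> \bar R}) (A : set T) :
  mu setT = 1%E -> measurable A -> mu A \is a fin_num.
Proof.
move=> mu1 mA; rewrite ge0_fin_numE//.
by apply: le_lt_trans (ltry 1%R); rewrite -mu1; apply: le_measure; rewrite ?inE.
Qed.

Lemma eq_radon (R : realType) (T : ptopologicalType)
    (mu nu : {measure set (borel T) -> \bar R}) :
  hausdorff_space T ->
  (forall B : set (borel T), measurable B -> mu B = nu B) -> radon mu -> radon nu.
Proof.
move=> hT munu [lf ir]; split.
  move=> x; have [U [oU Ux muU]] := lf x; exists U; split => //.
  by rewrite -munu//; exact: borel_open.
move=> B mB; rewrite -munu// (ir B mB); congr ereal_sup.
apply: eq_imagel => C [cC _]; apply: munu.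
by apply: borel_closed; exact: compact_closed.
Qed.

(** The image of a compact subset of the preimage of [B] is a compact subset of [B] with at least
    the same mass. *)
Lemma radon_pushforward (R : realType) (X Y : ptopologicalType)
    (f : X -> Y) (mu : {measure set (borel X) -> \bar R})
    (nu : {measure set (borel Y) -> \bar R}) :
  hausdorff_space X -> hausdorff_space Y -> continuous f ->
  (forall B : set (borel Y), measurable B -> nu B = mu (f @^-1` B)) ->
  mu setT = 1%E -> radon mu -> radon nu.
Proof.
move=> hX hY cf nuE mu1 [_ ir]; have mf := borel_continuous cf.
have mpre (B : set (borel Y)) : measurable B -> measurable (f @^-1` B : set (borel X)).
  by move=> mB; rewrite -[X in measurable X]setTI; exact: mf.
split.
  move=> x; exists setT; split => //; first exact: openT.
  by rewrite nuE// preimage_setT mu1 ltry.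
move=> B mB; apply/eqP; rewrite eq_le; apply/andP; split.
  rewrite nuE// ir; last exact: mpre.
  apply: ge_ereal_sup => _ [C [cC CB] <-].
  have cfC : compact (f @` C).
    by apply: continuous_compact => //; exact: continuous_subspaceT.
  have mfC : measurable (f @` C : set (borel Y)).
    by apply: borel_closed; exact: compact_closed.
  apply: (@le_trans _ _ (nu (f @` C))).
    rewrite nuE//; apply: le_measure; rewrite ?inE.
    - by apply: borel_closed; exact: compact_closed.
    - exact: mpre.
    - exact: preimage_image.
  apply: ereal_sup_ubound; exists (f @` C) => //; split => //.
  by move=> _ [x Cx <-]; exact: CB.
apply: ge_ereal_sup => _ [C [cC CB] <-]; apply: le_measure; rewrite ?inE//.
by apply: borel_closed; exact: compact_closed.
Qed.

Section CountablyGeneratedRadon.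
Context (R : realType) (B : characterAlgType R) (e : nat -> B).
Hypothesis ge : seq_generates e.
Variable mu : {measure set (borel (characters B)) -> \bar R}.
Hypothesis mu1 : mu setT = 1%E.

Local Open Scope ereal_scope.
Local Notation X := (characters B).

(** The sets where the absolute value of [b] exceeds [n] decrease to the empty set. *)
Let tight_strip (b : B) (eps : R) : (0 < eps)%R ->
  exists M : R, mu [set x | (M < `|gelfand b x|)%R] <= eps%:E.
Proof.
move=> eps0; pose F n := [set x : borel X | (n%:R < `|gelfand b x|)%R].
have mF n : measurable (F n).
  apply: borel_open; rewrite (_ : F n = [set x | (n%:R < gelfand b x)%R] `|`
      [set x | (gelfand b x < - n%:R)%R]).
    by apply: openU; [exact: open_gelfand_gt|exact: open_gelfand_lt].
  apply/seteqP; split => x /=; rewrite /F /= lter_normr ltrNr.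
    by move=> /orP[|]; [left|right].
  by move=> [->|->//]; rewrite ?orbT.
have F0 : \bigcap_n F n = set0.
  rewrite -subset0 => x /(_ (Num.bound `|gelfand b x|%R) I)/=.
  by move=> /(lt_trans (archi_boundP (normr_ge0 _))); rewrite ltxx.
have : (mu \o F) n @[n --> \oo] --> mu (\bigcap_n F n).
  apply: nonincreasing_cvg_mu => //.
  - by apply: (le_lt_trans _ (ltry 1%R)); rewrite -mu1; apply: le_measure; rewrite ?inE.
  - by rewrite F0.
  - move=> n p np; apply/subsetPset => x; rewrite /F/=; apply: le_lt_trans.
    by rewrite ler_nat.
rewrite F0 measure0 => /fine_cvgP[_] /cvgrPdist_le/(_ _ eps0)[N _ /(_ N (leqnn N))].
rewrite /= sub0r normrN ger0_norm ?fine_ge0// => HN.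
exists N%:R; rewrite -[X in X <= _]fineK ?lee_fin//.
exact: (fin_num_measure1 mu1 (mF N)).
Qed.

(** Each generator is bounded by some [M n] outside a set of mass at most [eps / 2 ^ n.+1]. On the
    intersection of these strips every element is bounded, by induction over the generators, so the
    intersection is compact. *)
Let tight (eps : R) : (0 < eps)%R ->
  exists2 C : set X, compact C & mu (~` C) <= eps%:E.
Proof.
move=> eps0.
have /choice[M HM] : forall n, exists M : R,
    mu [set x | (M < `|gelfand (e n) x|)%R] <= (eps / (2 ^ n.+1)%:R)%:E.
  by move=> n; apply: tight_strip; rewrite divr_gt0// ltr0n expn_gt0.
pose F n := [set x : X | (`|gelfand (e n) x| <= M n)%R].
have clF n : closed (F n).
  rewrite (_ : F n = (fun x => `|gelfand (e n) x|%R) @^-1` [set r | (r <= M n)%R])//.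
  apply: closed_comp; last exact: closed_le.
  move=> x _; apply: continuous_comp; first exact: gelfand_continuous.
  exact: norm_continuous.
have clC : closed (\bigcap_n F n) by apply: closed_bigI => n _; exact: clF.
exists (\bigcap_n F n).
  apply: compact_bounded_characters => //; apply: ge.
  - by exists 1%R => x _; rewrite /gelfand rmorph1 normr1.
  - move=> k a b [Ma Ha] [Mb Hb]; exists (`|k| * Ma + Mb)%R => x Cx.
    rewrite /gelfand linearP; apply: le_trans (ler_normD _ _) _.
    by apply: lerD; [rewrite normrM ler_wpM2l//; exact: Ha|exact: Hb].
  - move=> a b [Ma Ha] [Mb Hb]; exists (Ma * Mb)%R => x Cx.
    rewrite /gelfand rmorphM normrM; apply: ler_pM => //; [exact: Ha|exact: Hb].
  - by move=> n; exists (M n) => x; exact.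
have mFC n : measurable (~` F n : set (borel X)).
  by apply: measurableC; exact: borel_closed.
apply: (@le_trans _ _ (\sum_(n <oo) mu (~` F n))).
  apply: measure_sigma_subadditive => //.
    by apply: measurableC; exact: borel_closed.
  by rewrite setC_bigcap.
apply: le_trans (epsilon_trick0 xpredT (ltW eps0)).
apply: lee_nneseries => // n _; apply: le_trans (HM n).
rewrite (_ : ~` F n = [set x | (M n < `|gelfand (e n) x|)%R])//.
by apply/seteqP; split => x; rewrite /F/= ltNge => /negP.
Qed.

(** The outer measure of [mu] is a tight set function and yields a Radon measure [nu] below [mu] on
    open sets. Equal total mass puts [nu] above [mu] on closed sets, hence on countable unions of
    closed sets, and every open set is such a union. So the two agree on open sets, and then on all
    Borel sets. *)
Lemma radon_countably_generated : radon mu.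
Proof.
pose m (E : set X) : R := fine (mu_ext mu E).
have muT : mu_ext mu setT = 1 by rewrite measurable_mu_extE.
have mE E : mu_ext mu E = (m E)%:E.
  rewrite /m fineK// ge0_fin_numE ?mu_ext_ge0//.
  by apply: le_lt_trans (ltry 1%R); rewrite -muT; exact: le_mu_ext.
have mB (E : set (borel X)) : measurable E -> (m E)%:E = mu E.
  by move=> mE'; rewrite -mE measurable_mu_extE.
have m0 : m set0 = 0%R by apply: EFin_inj; rewrite mB// measure0.
have m1 : m setT = 1%R by apply: EFin_inj; rewrite -mE muT.
have mS (E : set (borel X)) : measurable E -> splits m E.
  move=> mE' Y; apply: EFin_inj; rewrite EFinD -!mE.
  by apply: sub_caratheodory; exact: sub_sigma_algebra.
have [|||||||nu [rnu nu1 nuG]] := @radon_extension R X m.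
- exact: characters_hausdorff.
- by [].
- by move=> E F EF; rewrite -lee_fin -!mE; exact: le_mu_ext.
- move=> E F; rewrite -lee_fin EFinD -!mE.
  exact: (outer_measureU2 (mu_ext mu : {outer_measure set _ -> \bar R})).
- by rewrite m1.
- move=> C D; apply: characters_separated => // b t.
  by apply: mS; apply: borel_open; exact: open_gelfand_lt.
- move=> eps eps0; have [C cC muC] := tight eps0; exists C => //.
  have mC : measurable (C : set (borel X)).
    by apply: borel_closed; apply: compact_closed => //; exact: characters_hausdorff.
  move: (measure_setC mu mC) muC; rewrite mu1 -!mB//; last exact: measurableC.
  by rewrite -EFinD lee_fin => -[] ? ?; lra.
have le_closed (F : set X) : closed F -> mu F <= nu F.
  move=> cF; have mF : measurable (F : set (borel X)) by exact: borel_closed.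
  have mF' : measurable (~` F : set (borel X)) by exact: measurableC.
  have := nuG _ (closed_openC cF) (mS _ mF'); rewrite mB//.
  have := measure_setC mu mF; have := measure_setC nu mF; rewrite mu1 nu1.
  rewrite -(fineK (fin_num_measure1 mu1 mF)) -(fineK (fin_num_measure1 mu1 mF')).
  rewrite -(fineK (fin_num_measure1 nu1 mF)) -(fineK (fin_num_measure1 nu1 mF')).
  by rewrite -!EFinD !lee_fin => -[] ? -[] ? ?; lra.
have eq_open (G : set X) : open G -> mu G = nu G.
  move=> oG; apply/eqP; rewrite eq_le; apply/andP; split; last first.
    by rewrite -mB ?nuG//; [apply: mS|]; exact: borel_open.
  have [| | | |F clF GF] := open_bigcup_box (Q := closed) ge _ _ _ _ oG.
  - exact: closed0.
  - exact: closedT.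
  - move=> b q r.
    rewrite (_ : mkset _ = ~` [set x | (q + r < gelfand b x)%R] `&`
        ~` [set x | (gelfand b x < q - r)%R]).
      by apply: closedI; apply: open_closedC;
        [exact: open_gelfand_gt|exact: open_gelfand_lt].
    apply/seteqP; split => x /=.
      by rewrite ler_norml => /andP[? ?]; split; apply/negP; rewrite -leNgt; lra.
    by move=> [/negP + /negP]; rewrite -!leNgt ler_norml => ? ?; apply/andP; split; lra.
  - by move=> U V; exact: closedI.
  (* Finite unions make the closed sets increasing, so that continuity from below carries the
     inequality to [G]. *)
  pose H n := \big[setU/set0]_(i < n) F i.
  have clH n : closed (H n) by exact: closed_bigsetU.
  have mH n : measurable (H n : set (borel X)) by exact: borel_closed.
  have GH : G = \bigcup_n H n.
    rewrite GF /H; apply/seteqP; split => x [n _ Fx].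
      by exists n.+1 => //; rewrite big_ord_recr; right.
    by move: Fx; rewrite -bigcup_mkord => -[i _ Fx]; exists i.
  have mUH : measurable (\bigcup_n H n : set (borel X)).
    by rewrite -GH; exact: borel_open.
  have ndH : nondecreasing_seq H.
    by move=> n p np; apply/subsetPset; exact: subset_bigsetU.
  rewrite GH; apply: lee_cvg_to (nondecreasing_cvg_mu mH mUH ndH)
    (nondecreasing_cvg_mu mH mUH ndH) _.
  by apply: nearW => n; exact: le_closed.
apply: (eq_radon (@characters_hausdorff _ _) _ rnu) => E mE'.
apply: (@measure_unique _ R (borel X) (@open X) (fun=> setT)) => //.
- by move=> ? ? ? ?; exact: openI.
- by move=> _; exact: openT.
- by rewrite bigcup_const.
- by move=> G oG; rewrite eq_open.
- by move=> _; rewrite nu1 ltry.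
Qed.

End CountablyGeneratedRadon.

(** * Moments *)

Section Transfer.
Local Open Scope ereal_scope.
Context d1 d2 (X : measurableType d1) (Y : measurableType d2) (R : realType).
Variables (f : X -> Y) (mu : {measure set X -> \bar R}).
Variable nu : {measure set Y -> \bar R}.
Hypothesis mf : measurable_fun [set: X] f.
Hypothesis nuE : forall B, measurable B -> nu B = mu (f @^-1` B).

Lemma ge0_integral_transfer (g : Y -> \bar R) :
  measurable_fun setT g -> (forall y, 0 <= g y) ->
  \int[nu]_y g y = \int[mu]_x g (f x).
Proof.
move=> mg g0; rewrite (@eq_measure_integral _ _ _ _ (pushforward mu f)); last first.
  by move=> B mB _; exact: nuE.
by rewrite ge0_integral_pushforward.
Qed.

Lemma integrable_transfer (g : Y -> \bar R) : measurable_fun setT g ->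
  nu.-integrable setT g <-> mu.-integrable setT (g \o f).
Proof.
move=> mg; have E : \int[nu]_y `|g y| = \int[mu]_x `|g (f x)|.
  by apply: ge0_integral_transfer => //; exact: measurableT_comp.
split => /integrableP[_]; rewrite ?E => lty; apply/integrableP; split => //.
- exact: measurableT_comp.
- by rewrite E.
Qed.

Lemma integral_transfer (g : Y -> \bar R) : measurable_fun setT g ->
  mu.-integrable setT (g \o f) -> \int[nu]_y g y = \int[mu]_x g (f x).
Proof.
move=> mg ig; rewrite (@eq_measure_integral _ _ _ _ (pushforward mu f)); last first.
  by move=> B mB _; exact: nuE.
by rewrite integral_pushforward.
Qed.

End Transfer.

(** Heights start at [k.+1], so that [e] times the sum of the indicators stays below a nonnegative
    [f] and misses it by at most [e]. *)
Definition layer (R : numDomainType) (X : Type) (f : X -> R) (e : R) (k : nat) :=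
  [set x | k.+1%:R * e < f x].

Section Layers.
Context d (X : measurableType d) (R : realType).
Variable mu : {measure set X -> \bar R}.
Variable f : X -> R.
Hypothesis mf : measurable_fun [set: X] f.
Hypothesis f0 : forall x, 0 <= f x.
Implicit Type e : R.

Lemma measurable_layer e k : d.-measurable (layer f e k).
Proof.
rewrite -[layer f e k]setTI (_ : layer f e k = f @^-1` `]k.+1%:R * e, +oo[%classic).
  exact: mf.
by apply/seteqP; split => x; rewrite /layer/= in_itv/= andbT.
Qed.

Let indic_layer e k x : \1_(layer f e k) x = (k.+1%:R * e < f x)%R%:R :> R.
Proof. by rewrite indicE; congr (nat_of_bool _)%:R; apply/idP/idP; rewrite inE. Qed.

Lemma sum_layer_le e N x : 0 < e -> \sum_(k < N) e * \1_(layer f e k) x <= f x.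
Proof.
move=> e0.
(* The second bound carries the induction: if the new layer contains [x], the enlarged sum is at
   most [N.+1%:R * e], which is below [f x]. *)
suff : \sum_(k < N) e * \1_(layer f e k) x <= f x /\
       \sum_(k < N) e * \1_(layer f e k) x <= N%:R * e by case.
elim: N => [|N [ih1 ih2]]; first by rewrite big_ord0 mul0r.
rewrite big_ord_recr/= indic_layer; case: ltP => /= h; rewrite ?mulr1 ?mulr0 ?addr0.
  by move: h ih2; rewrite -natr1 => h ih2; split; lra.
by split => //; rewrite -natr1; lra.
Qed.

Lemma sum_layer_ge e N x : 0 < e -> f x <= N.+1%:R * e ->
  f x <= e + \sum_(k < N) e * \1_(layer f e k) x.
Proof.
move=> e0.
(* Truncating [f x] at the top level gives a statement that holds for every [N] and is provable by
   induction. *)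
suff : Num.min (f x) (N.+1%:R * e) <= e + \sum_(k < N) e * \1_(layer f e k) x.
  by move=> + h; rewrite (min_idPl h).
elim: N => [|N ih]; first by rewrite big_ord0 mul1r addr0 ge_min lexx orbT.
rewrite big_ord_recr/= indic_layer; have [h|h] := ltP; rewrite ?mulr1 ?mulr0 ?addr0.
  move: ih; rewrite (min_idPr (ltW h)) => ih; rewrite ge_min; apply/orP; right.
  by rewrite -natr1; lra.
by move: ih; rewrite (min_idPl h) => ih; rewrite ge_min ih.
Qed.

Local Open Scope ereal_scope.

Let integral_layer e k : (0 < e)%R ->
  \int[mu]_x (e * \1_(layer f e k) x)%:E = e%:E * mu (layer f e k).
Proof.
move=> e0; under eq_integral do rewrite EFinM.
rewrite ge0_integralZl_EFin//; last exact: ltW.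
- by rewrite integral_indic// ?setIT//; exact: measurable_layer.
- by apply/measurable_EFinP; apply: measurable_indic; exact: measurable_layer.
Qed.

Let measurable_term e k : measurable_fun setT (fun x => (e * \1_(layer f e k) x)%:E).
Proof.
apply/measurable_EFinP; apply: measurable_funM => //.
by apply: measurable_indic; exact: measurable_layer.
Qed.

Lemma sum_layer_le_integral e N : (0 < e)%R ->
  \sum_(k < N) e%:E * mu (layer f e k) <= \int[mu]_x (f x)%:E.
Proof.
move=> e0; under eq_bigr do rewrite -integral_layer//.
rewrite -ge0_integral_sum//; last first.
  by move=> k x _; rewrite lee_fin mulr_ge0// ltW.
apply: ge0_le_integral => //.
- by move=> x _; apply: sume_ge0 => k _; rewrite lee_fin mulr_ge0// ltW.
- exact: emeasurable_sum.
- exact/measurable_EFinP.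
- by move=> x _; rewrite sumEFin lee_fin sum_layer_le.
Qed.

(** This turns bounds known only for the masses of superlevel sets into a bound on the integral: [f]
    is at most [e] plus the full layer series, whose integral is at most [c], and [e] is
    arbitrary. *)
Lemma integral_le_sum_layer (c : R) : mu setT = 1 ->
  (forall (e : R) N, (0 < e)%R -> \sum_(k < N) e%:E * mu (layer f e k) <= c%:E) ->
  \int[mu]_x (f x)%:E <= c%:E.
Proof.
move=> mu1 H; apply/lee_addgt0Pr => e e0.
have t0 k x : 0 <= (e * \1_(layer f e k) x)%:E.
  by rewrite lee_fin mulr_ge0// ltW.
pose s x := \sum_(k <oo) (e * \1_(layer f e k) x)%:E.
have ms : measurable_fun setT s by exact: ge0_emeasurable_sum.
have s0 x : 0 <= s x by apply: nneseries_ge0.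
apply: (@le_trans _ _ (\int[mu]_x (cst e%:E x + s x))).
  apply: ge0_le_integral => //.
  - by move=> x _; rewrite lee_fin.
  - exact/measurable_EFinP.
  - exact: emeasurable_funD.
  - move=> x _; pose N := Num.bound (f x / e).
    have fN : (f x <= N.+1%:R * e)%R.
      rewrite -ler_pdivrMr//; apply: ltW; apply: lt_le_trans (archi_boundP _) _.
        by rewrite divr_ge0// ltW.
      by rewrite ler_nat.
    apply: (@le_trans _ _ (e%:E + \sum_(k < N) (e * \1_(layer f e k) x)%:E)).
      by rewrite sumEFin -EFinD lee_fin; exact: sum_layer_ge.
    rewrite leeD2l// -(big_mkord xpredT (fun k => (e * \1_(layer f e k) x)%:E)).
    exact: nneseries_lim_ge.
rewrite ge0_integralD//; last by move=> x _; rewrite lee_fin ltW.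
rewrite integral_cst// mu1 mule1 addeC leeD2r//.
rewrite integral_nneseries//; apply: lime_le.
  by apply: is_cvg_nneseries => k _ _; exact: integral_ge0.
apply: nearW => N; rewrite big_mkord.
under eq_bigr do rewrite integral_layer//.
exact: H.
Qed.

End Layers.

Section Moments.
Context d (X : measurableType d) (R : realType) (A : comAlgType R).
Variable mu : {measure set X -> \bar R}.
Variable phi : X -> characters A.
Variable L : {scalar A}.
Hypothesis mu1 : mu setT = 1%E.
Hypothesis mphi : forall a, measurable_fun setT (fun x => gelfand a (phi x)).
Hypothesis L1 : L 1 = 1.
Hypothesis L2 : forall a,
  (\int[mu]_x (gelfand a (phi x) ^+ 2)%:E <= (L (a ^+ 2))%:E)%E.

(* The inequality [L2] for [1 + t a] reads [1 + 2 t I + t^2 J <= 1 + 2 t L a +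
   t^2 L(a^2)] with [I], [J] the first two moments of [a]; letting [t] tend to
   [0] from both sides gives [I = L a]. *)
Lemma moments_of_squares (a : A) :
  mu.-integrable setT (fun x => (gelfand a (phi x))%:E) /\
  ((L a)%:E = \int[mu]_x (gelfand a (phi x))%:E)%E.
Proof.
pose g x := gelfand a (phi x).
have mg : measurable_fun setT g by exact: mphi.
have int2 : mu.-integrable setT (EFin \o (fun x => g x ^+ 2)).
  apply/integrableP; split.
    by apply/measurable_EFinP; exact: measurable_funX.
  apply: le_lt_trans (ltry (L (a ^+ 2))); apply: le_trans (L2 a).
  rewrite le_eqVlt; apply/orP; left; apply/eqP; apply: eq_integral => x _ /=.
  by rewrite ger0_norm// sqr_ge0.
have intc (c : R) : mu.-integrable setT (EFin \o cst c).
  apply/integrableP; split; first exact/measurable_EFinP.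
  by rewrite (eq_integral (cst `|c|%:E))// integral_cst// mu1 mule1 ltry.
have int1 : mu.-integrable setT (EFin \o g).
  (* The absolute value of [g] is dominated by [1 + g ^+ 2]. *)
  apply: (le_integrable measurableT _ _ (integrableD measurableT (intc 1) int2)).
    exact/measurable_EFinP.
  move=> x _ /=; rewrite lee_fin [leRHS]ger0_norm; last first.
    by rewrite addr_ge0// sqr_ge0.
  by rewrite ler_norml; apply/andP; split; nra.
split => //.
pose I := (\int[mu]_x (g x)%:E)%E.
pose J := (\int[mu]_x (g x ^+ 2)%:E)%E.
have I1 : I \is a fin_num := integrable_fin_num measurableT int1.
have I2 : J \is a fin_num := integrable_fin_num measurableT int2.
have key t : 1 + 2 * t * fine I + t ^+ 2 * fine J <=
    1 + 2 * t * L a + t ^+ 2 * L (a ^+ 2).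
  have := L2 (1 + t *: a).
  rewrite (_ : (\int[mu]_x _)%E = \int[mu]_x (((cst 1 x)%:E + ((2 * t)%:E * (g x)%:E)) +
      (t ^+ 2)%:E * (g x ^+ 2)%:E))%E; last first.
    apply: eq_integral => x _; rewrite -!EFinM -!EFinD; congr EFin.
    have -> : gelfand (1 + t *: a) (phi x) = t * g x + 1.
      by rewrite addrC /gelfand linearP rmorph1.
    by rewrite /cst; lra.
  rewrite integralD//; last 2 first.
  - by apply: integrableD => //; [exact: intc|exact: integrableZl].
  - exact: integrableZl.
  rewrite integralD//; [|exact: intc|exact: integrableZl].
  rewrite !integralZl// (integral_cst mu measurableT 1%E) mu1 mul1e -/I -/J -(fineK I1) -(fineK I2).
  rewrite -!EFinM -!EFinD lee_fin => /le_trans; apply.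
  rewrite (_ : (1 + t *: a) ^+ 2 = 1 + (2 * t) *: a + (t ^+ 2) *: (a ^+ 2)).
    by rewrite !linearD !linearZ/= L1.
  rewrite sqrrD expr1n mul1r exprZn mulr2n -scalerDl; congr (_ + _ *: _ + _).
  by lra.
suff : L a = fine I by move=> ->; rewrite fineK.
move: key (key 1) (key (-1)).
set i := fine I; set j := fine J; set l2 := L (a ^+ 2) => key.
rewrite sqrrN !expr1n => k1 k2.
have q0 : j <= l2 by lra.
(* At this [t], with [q = l2 - j >= 0], the inequality [key] reads [2 t^2 (q + 1) <= t^2 q], which
   forces [t = 0]. The added 1 keeps the denominator positive. *)
pose t := (i - L a) / (l2 - j + 1).
have it : i = L a + t * (l2 - j + 1) by rewrite /t divfK ?subrKC//; lra.
suff : t = 0 by move=> t0; rewrite it t0 mul0r addr0.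
apply/eqP; rewrite -sqrf_eq0 eq_le sqr_ge0 andbT.
have := key t; rewrite it; nra.
Qed.

End Moments.

(** * Cylinder measures and thick systems *)

Lemma preimage_measurable d1 d2 (X : measurableType d1) (Y : measurableType d2)
    (f : X -> Y) (B : set Y) :
  measurable_fun setT f -> measurable B -> measurable (f @^-1` B).
Proof. by move=> mf mB; rewrite -[X in measurable X]setTI; exact: mf. Qed.

Lemma measurable_restr_sub_preimage (R : realType) (A : characterAlgType R)
    (S T : subalgClosed A) (ST : {subset S <= T})
    (B : set (borel (characters (subalg S)))) : measurable B ->
  measurable (restr_sub ST @^-1` B : set (borel (characters (subalg T)))).
Proof.
move=> mB.
have mf := @borel_continuous (characters (subalg T)) (characters (subalg S))
  (restr_sub ST) (@restr_sub_continuous _ _ _ _ ST).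
by rewrite -[X in measurable X]setTI; exact: mf.
Qed.

Section Marginals.
Context {R : realType}.

Lemma representing_total (B : characterAlgType R) (G : set (set (characters B)))
    (l : {scalar B}) K (nu : {measure set (g_sigma_algebraType G) -> \bar R}) :
  l 1 = 1 -> representing l K nu -> nu setT = 1%E.
Proof.
move=> l1 [_ /(_ 1)[_]]; rewrite l1 (eq_integral (cst 1%E)).
  by rewrite integral_cst// mul1e => <-.
by move=> x _; rewrite /= /gelfand rmorph1.
Qed.

Context (A : characterAlgType R).

(** A strip involves a single element, which lies in a finitely generated subalgebra, so its
    preimage is a cylinder. Every open set is a countable union of finite intersections of
    strips. *)
Lemma restr_cylinder_measurable (T : subalgClosed A) : countably_generated T ->
  measurable_fun setT (restr T : g_sigma_algebraType (cylinders A) ->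
    borel (characters (subalg T))).
Proof.
move=> /countably_generated_seq[e ge]; apply: measurable_fun_borel => G oG.
pose Q (V : set (characters (subalg T))) :=
  measurable (restr T @^-1` V : set (g_sigma_algebraType (cylinders A))).
have [| | | |F QF ->] := @open_bigcup_box R _ e Q ge _ _ _ _ G oG.
- by rewrite /Q preimage_set0.
- by rewrite /Q preimage_setT.
- move=> b q r; have [S fS bS] := fin_generated_mem (val b).
  apply: sub_sigma_algebra; exists S; split => //.
  pose b' : subalg S := exist _ (val b) bS.
  exists [set x | `|gelfand b' x - q| <= r] => //.
  rewrite (_ : mkset _ = ~` [set x | (q + r < gelfand b' x)%R] `&`
        ~` [set x | (gelfand b' x < q - r)%R]).
    by apply: measurableI; apply: measurableC; apply: borel_open;
      [exact: open_gelfand_gt|exact: open_gelfand_lt].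
  apply/seteqP; split => x /=.
    by rewrite ler_norml => /andP[? ?]; split; apply/negP; rewrite -leNgt; lra.
  by move=> [/negP + /negP]; rewrite -!leNgt ler_norml => ? ?; apply/andP; split; lra.
- by move=> U V QU QV; rewrite /Q preimage_setI; exact: measurableI.
by rewrite preimage_bigcup; apply: bigcupT_measurable => n; exact: QF.
Qed.

(** Families are total functions, so a subalgebra outside [P] receives the zero measure. *)
Lemma marginals (G : set (set (characters A))) (P : subalgClosed A -> Prop)
    (mu : {measure set (g_sigma_algebraType G) -> \bar R}) :
  (forall T, P T -> measurable_fun setT
    (restr T : g_sigma_algebraType G -> borel (characters (subalg T)))) ->
  exists mf : measure_family A, forall T, P T ->
    forall B : set (borel (characters (subalg T))), measurable B ->
    mf T B = mu (restr T @^-1` B).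
Proof.
move=> mrestr.
suff H T : exists m : {measure set (borel (characters (subalg T))) -> \bar R},
    P T -> forall B, measurable B -> m B = mu (restr T @^-1` B).
  by exists (fun T => projT1 (cid (H T))) => T; case: cid.
have [PT|nPT] := pselect (P T); last by exists mzero.
pose f : g_sigma_algebraType G -> borel (characters (subalg T)) := restr T.
have mf : measurable_fun setT f by exact: mrestr.
by unshelve (exists (pushforward mu f)).
Qed.

Lemma marginal_representing (G : set (set (characters A))) (L : {scalar A}) K0
    (mu : {measure set (g_sigma_algebraType G) -> \bar R})
    (S : subalgClosed A) (K : set (characters (subalg S)))
    (nu : {measure set (borel (characters (subalg S))) -> \bar R}) :
  representing L K0 mu ->
  measurable_fun setT
    (restr S : g_sigma_algebraType G -> borel (characters (subalg S))) ->
  (forall B : set (borel (characters (subalg S))), measurable B ->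
    nu B = mu (restr S @^-1` B)) ->
  closed K -> mu (~` (restr S @^-1` K)) = 0%E ->
  representing (L \o subalg_val S) K nu.
Proof.
move=> [_ muL] mS nuE cK muK; have mK := borel_closed cK; split.
  by split; [exact: mK|rewrite (nuE _ (measurableC mK)) preimage_setC].
move=> b; have [ia ea] := muL (subalg_val S b).
have mb : measurable_fun setT (EFin \o (gelfand b : borel _ -> R)).
  by apply/measurable_EFinP; exact: gelfand_measurable.
split; first by apply/(integrable_transfer mS nuE mb).
by rewrite (integral_transfer mS nuE mb)// ea.
Qed.

(** Two predicates let one statement cover exactness over finitely generated subalgebras, exactness
    over countably generated ones, and compatibility between the two. *)
Lemma marginal_exact (G : set (set (characters A)))
    (P Q : subalgClosed A -> Prop)
    (mu : {measure set (g_sigma_algebraType G) -> \bar R}) (mf : measure_family A) :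
  (forall T, Q T -> forall B : set (borel (characters (subalg T))), measurable B ->
    mf T B = mu (restr T @^-1` B)) ->
  (forall T, P T -> Q T) -> forall (S T : subalgClosed A) (ST : {subset S <= T}),
  P S -> Q T -> forall B : set (borel (characters (subalg S))), measurable B ->
    pushforward (mf T) (restr_sub ST : borel _ -> borel _) B = mf S B.
Proof.
move=> mfE PQ S T ST /PQ QS QT B mB; rewrite /pushforward !mfE//.
  by rewrite restr_sub_preimage.
exact: measurable_restr_sub_preimage.
Qed.

End Marginals.

Section Glue.
Context {R : realType} (A : characterAlgType R) (muL : measure_family A).
Hypothesis exL : exact_system countably_generated muL.
Hypothesis thL : thick muL.

Local Open Scope ereal_scope.

(** Both differences of [B] and [B'] miss the range of [restr T], hence are null, and both masses
    equal that of the intersection. *)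
Let glue_uniq_sub (T : subalgClosed A) (B B' : set (borel (characters (subalg T)))) :
  countably_generated T -> measurable B -> measurable B' ->
  restr T @^-1` B = restr T @^-1` B' -> muL T B = muL T B'.
Proof.
move=> cT mB mB' BB'.
have null (C C' : set (borel (characters (subalg T)))) : measurable C -> measurable C' ->
    restr T @^-1` C = restr T @^-1` C' -> muL T (C `\` C') = 0.
  move=> mC mC' CC'; apply: thL => //; first exact: measurableD.
  rewrite -subset0 => _ [[x _ <-] [Cx nC'x]]; apply: nC'x.
  by rewrite -[C' _]/((restr T @^-1` C') x) -CC'.
rewrite (measureDI _ mB mB') (measureDI _ mB' mB) [B' `&` B]setIC.
congr (_ + _); apply: (etrans (null _ _ mB mB' BB')).
by apply/esym; exact: (null _ _ mB' mB (esym BB')).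
Qed.

Let glue_uniq (S T : subalgClosed A) (B : set (borel (characters (subalg S))))
    (C : set (borel (characters (subalg T)))) :
  countably_generated S -> countably_generated T -> measurable B -> measurable C ->
  restr S @^-1` B = restr T @^-1` C -> muL S B = muL T C.
Proof.
move=> cS cT mB mC BC.
have [U [cU SU TU]] := countably_generated_join2 cS cT.
rewrite -(exL SU cS cU mB) -(exL TU cT cU mC); apply: glue_uniq_sub => //; last by rewrite !restr_sub_preimage.
- exact: measurable_restr_sub_preimage.
- exact: measurable_restr_sub_preimage.
Qed.

(* A cylinder set may come from different countably generated subalgebras; two
   base sets in a common larger one differ by a set that misses the restrictions
   of characters of [A], hence is null by thickness. *)
Let glue (E : set (characters A)) : \bar R :=
  xget 0 [set v | exists T, countably_generated T /\
    exists2 B : set (borel (characters (subalg T))),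
      measurable B & E = restr T @^-1` B /\ v = muL T B].

Let glueE (T : subalgClosed A) (B : set (borel (characters (subalg T)))) :
  countably_generated T -> measurable B -> glue (restr T @^-1` B) = muL T B.
Proof.
move=> cT mB; rewrite /glue; set P := mkset _.
have /(xgetPex 0) : exists v, P v by exists (muL T B); exists T; split => //; exists B.
move=> [S [cS [C mC [BC ->]]]]; exact: glue_uniq.
Qed.

(** The preimages of Borel sets over countably generated subalgebras already form a sigma-algebra,
    since [join] moves a sequence of them to a common base; [join] also gives the simultaneous
    representation. *)
Let cylinder_repr (E : nat -> set (g_sigma_algebraType (cylinders A))) :
  (forall n, measurable (E n)) -> exists2 T : subalgClosed A,
  countably_generated T & exists B : nat -> set (borel (characters (subalg T))),
  forall n, measurable (B n) /\ E n = restr T @^-1` B n.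
Proof.
have join (F : nat -> set (characters A)) :
    (forall n, exists2 T : subalgClosed A, countably_generated T &
      exists2 B : set (borel (characters (subalg T))), measurable B &
      F n = restr T @^-1` B) ->
    exists2 T : subalgClosed A,
    countably_generated T & exists B : nat -> set (borel (characters (subalg T))),
    forall n, measurable (B n) /\ F n = restr T @^-1` B n.
  move=> HF; have /choice[S HS] : forall n, exists T : subalgClosed A,
    countably_generated T /\
      exists2 B : set (borel (characters (subalg T))), measurable B &
      F n = restr T @^-1` B by move=> n; have [T cT ?] := HF n; exists T.
  have [T cT ST] := countably_generated_join (fun n => (HS n).1).
  exists T => //; suff /choice[g Hg] : forall n,
    exists B : set (borel (characters (subalg T))), measurable B /\ F n = restr T @^-1` B by exists g.
  move=> n; have [_ [B mB ->]] := HS n.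
  exists (restr_sub (ST n) @^-1` B); rewrite restr_sub_preimage.
  by split => //; exact: measurable_restr_sub_preimage.
move=> mE; apply: (join E) => n.
suff sub : <<s cylinders A >> `<=` [set F | exists2 T : subalgClosed A,
  countably_generated T & exists2 B : set (borel (characters (subalg T))),
  measurable B & F = restr T @^-1` B] by exact: sub _ (mE n).
apply: smallest_sub.
  split.
  - have [S fS _] := fin_generated_mem (1 : A).
    by exists S; [exact: fin_generated_countably|exists set0 => //; rewrite preimage_set0].
  - move=> _ [T cT [B mB ->]]; exists T => //; exists (~` B); first exact: measurableC.
    by rewrite setTD preimage_setC.
  - move=> F /join[T cT [B HB]]; exists T => //; exists (\bigcup_n B n).
      by apply: bigcupT_measurable => k; have [] := HB k.
    by rewrite preimage_bigcup; apply: eq_bigcupr => k _; have [] := HB k.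
move=> _ [S [fS [B mB ->]]]; exists S; first exact: fin_generated_countably.
by exists B.
Qed.

Let glue0 : glue set0 = 0.
Proof.
have [S fS _] := fin_generated_mem (1 : A).
rewrite -(preimage_set0 (restr S)) glueE//; exact: fin_generated_countably.
Qed.

Let glue_ge0 (E : set (g_sigma_algebraType (cylinders A))) : 0 <= glue E.
Proof.
rewrite /glue; case: xgetP => [v -> [T [_ [B _ [_ ->]]]]|_]; last exact: lexx.
exact: measure_ge0.
Qed.

Let glue_sigma_additive :
  semi_sigma_additive (glue : set (g_sigma_algebraType (cylinders A)) -> \bar R).
Proof.
move=> F mF tF _; have [T cT [B HB]] := cylinder_repr mF.
have mB n : measurable (B n) by have [] := HB n.
(* Disjointness of the [F n] makes the [B n] disjoint only on the range of [restr T]; [seqDU] makes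
   them disjoint everywhere without changing the preimages. *)
have FE n : F n = restr T @^-1` (seqDU B n).
  have [_ ->] := HB n; apply/seteqP; split => x; last by case.
  move=> Bx; split => //; rewrite -bigcup_mkord => -[i /= ilt Bix].
  have : (F i `&` F n) x by have [_ ->] := HB i; have [_ ->] := HB n.
  move/trivIsetP : tF => /(_ i n I I); rewrite lt_eqF// => /(_ isT) -> //.
have mD n : measurable (seqDU B n).
  by apply: measurableD => //; apply: bigsetU_measurable.
rewrite (_ : \bigcup_n F n = restr T @^-1` (\bigcup_n seqDU B n)); last first.
  by rewrite preimage_bigcup; apply: eq_bigcupr => n _; exact: FE.
rewrite glueE//; last exact: bigcupT_measurable.
rewrite (_ : (fun n => _) = (fun n => \sum_(0 <= i < n) muL T (seqDU B i))).
  apply: measure_semi_sigma_additive => //.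
  exact: bigcupT_measurable.
by apply/funext => n; apply: eq_bigr => i _; rewrite FE glueE.
Qed.

#[local] HB.instance Definition _ :=
  isMeasure.Build _ _ _ (glue : set (g_sigma_algebraType (cylinders A)) -> \bar R)
    glue0 glue_ge0 glue_sigma_additive.

Lemma thick_system_measure :
  exists mu : {measure set (g_sigma_algebraType (cylinders A)) -> \bar R},
  forall T, countably_generated T ->
  forall B : set (borel (characters (subalg T))), measurable B ->
  mu (restr T @^-1` B) = muL T B.
Proof. by exists glue => T cT B mB; exact: (glueE cT mB). Qed.

End Glue.

(** * Prokhorov's condition *)

(** The section filter of the directed set of finitely generated subalgebras, carried by the type of
    all subalgebras. *)
Definition fin_generated_tails (R : realType) (A : comAlgType R) :
    set_system (subalgClosed A) := fun V =>
  exists2 S, fin_generated S & forall T, fin_generated T -> {subset S <= T} -> V T.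

Lemma fin_generated_tails_filter (R : realType) (A : comAlgType R) :
  ProperFilter (@fin_generated_tails R A).
Proof.
split; first by move=> [S fS /(_ S fS (fun _ => id))].
split.
- by have [S fS _] := fin_generated_mem (1 : A); exists S.
- move=> V W [S fS HS] [S' fS' HS'].
  have [T [fT ST ST']] := fin_generated_join fS fS'; exists T => // T' fT' TT'.
  by split; [apply: HS|apply: HS'] => // x xS; apply: TT'; [exact: ST|exact: ST'].
- by move=> V W VW [S fS HS]; exists S => // T fT ST; apply: VW; exact: HS.
Qed.

Section Prokhorov.
Context (R : realType) (A : characterAlgType R) (L : {scalar A}).
Variables (K : forall S : subalgClosed A, set (characters (subalg S))).
Variable mu : measure_family A.
Arguments K : clear implicits.
Hypothesis L1 : L 1 = 1.
Hypothesis clK : forall S : subalgClosed A, fin_generated S -> closed (K S).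
Hypothesis subK : forall (S T : subalgClosed A) (ST : {subset S <= T}),
  fin_generated S -> fin_generated T -> restr_sub ST @` K T `<=` K S.
Hypothesis muK : forall S : subalgClosed A, fin_generated S ->
  representing_radon (L \o subalg_val S) (K S) (mu S).
Hypothesis tight_mu : prokhorov mu.

Let mu1 S : fin_generated S -> mu S setT = 1%E.
Proof. by move=> /muK[rS _]; apply: representing_total rS; rewrite /= rmorph1. Qed.

Variable U : set_system (subalgClosed A).
Hypothesis uU : UltraFilter U.
Hypothesis tailsU : @fin_generated_tails R A `<=` U.

Let pU : ProperFilter U := @ultra_proper _ _ uU.
#[local] Existing Instance pU.

(** The outer measure is taken because the image of [E] under restriction need not be Borel. *)
Let r (T : subalgClosed A) (E : set (characters A)) : R :=
  fine (mu_ext (mu T) (restr T @` E)).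

Let rE T E : fin_generated T -> mu_ext (mu T) (restr T @` E) = (r T E)%:E.
Proof.
move=> fT; rewrite /r fineK// ge0_fin_numE ?mu_ext_ge0//.
apply: le_lt_trans (ltry 1%R); rewrite -(mu1 fT) -(measurable_mu_extE (mu T))//.
exact: le_mu_ext.
Qed.

Let r_le T (M : set (characters A)) (N : set (borel (characters (subalg T)))) :
  fin_generated T -> measurable N -> M `<=` restr T @^-1` N ->
  ((r T M)%:E <= mu T N)%E.
Proof.
move=> fT mN MN; rewrite -rE// -(measurable_mu_extE (mu T))//.
by apply: le_mu_ext => _ [x /MN Nx <-].
Qed.

Let r_itv T E : fin_generated T -> 0 <= r T E <= 1.
Proof.
move=> fT; apply/andP; split; first by rewrite fine_ge0// mu_ext_ge0.
rewrite -lee_fin -(mu1 fT); exact: r_le.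
Qed.

(* [m] need not be countably additive, not even on cylinder sets: only its
   values on compact and on open cylinder sets survive in the Radon measure. *)
Let m (E : set (characters A)) : R := lim ((r ^~ E) @ U).

Let nearU (P : subalgClosed A -> Prop) S : fin_generated S ->
  (forall T, fin_generated T -> {subset S <= T} -> P T) -> \forall T \near U, P T.
Proof. by move=> fS HP; apply: tailsU; exists S. Qed.

Let nearU_fin (P : subalgClosed A -> Prop) :
  (forall T, fin_generated T -> P T) -> \forall T \near U, P T.
Proof.
move=> HP; have [S fS _] := fin_generated_mem (1 : A).
by apply: (nearU fS) => T fT _; exact: HP.
Qed.

Let m_cvg E : (r ^~ E) @ U --> m E.
Proof.
by apply: (@ultra_bounded_cvg _ _ _ _ 0 1 uU); apply: nearU_fin => T fT; exact: r_itv.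
Qed.

Let lim_ge0 (h : subalgClosed A -> R) (l : R) :
  (\forall l \near U, 0 <= h l) -> h @ U --> l -> 0 <= l.
Proof.
move=> h0 hl.
exact: (@closed_cvg _ _ U pU h (fun t : R => 0 <= t) (@closed_ge R 0) h0 l hl).
Qed.

Let m_mono E F : E `<=` F -> m E <= m F.
Proof.
move=> EF; rewrite -subr_ge0; apply: (lim_ge0 _ (cvgB (@m_cvg F) (@m_cvg E))).
apply: nearU_fin => T fT.
rewrite subr_ge0 -lee_fin -!rE//; apply: le_mu_ext.
exact: image_subset.
Qed.

Let mU E F : m (E `|` F) <= m E + m F.
Proof.
rewrite -subr_ge0; apply: (lim_ge0 _ (cvgB (cvgD (@m_cvg E) (@m_cvg F)) (@m_cvg _))).
apply: nearU_fin => T fT.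
rewrite subr_ge0 -lee_fin EFinD -!rE// image_setU.
exact: (outer_measureU2 (mu_ext (mu T) : {outer_measure set _ -> \bar R})).
Qed.

Let m_le E c : (\forall T \near U, r T E <= c) -> m E <= c.
Proof.
move=> H; rewrite -subr_ge0; apply: (lim_ge0 _ (cvgB (cvg_cst c) (@m_cvg E))).
by apply: filterS H => T; rewrite subr_ge0.
Qed.

Let m_ge E c : (\forall T \near U, c <= r T E) -> c <= m E.
Proof.
move=> H; rewrite -subr_ge0; apply: (lim_ge0 _ (cvgB (@m_cvg E) (cvg_cst c))).
by apply: filterS H => T; rewrite subr_ge0.
Qed.

Let m0 : m set0 = 0.
Proof.
have r0 T : fin_generated T -> r T set0 = 0.
  by move=> fT; apply: EFin_inj; rewrite -rE// image_set0 mu_ext0.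
by apply/eqP; rewrite eq_le m_le ?m_ge//; apply: nearU_fin => T fT; rewrite r0.
Qed.

(** Taking images under [restr T] commutes with intersecting by a preimage, so from [S] on the
    identity is Carathéodory's condition for the outer measure of [mu T]; it then passes to the
    limit. *)
Let m_splits (S : subalgClosed A) (M : set (characters A)) : fin_generated S ->
  (forall T, fin_generated T -> {subset S <= T} ->
    exists2 N : set (borel (characters (subalg T))), measurable N &
    M = restr T @^-1` N) ->
  splits m M.
Proof.
move=> fS HM E.
have rM T : fin_generated T -> {subset S <= T} ->
    r T E = r T (E `&` M) + r T (E `&` ~` M).
  move=> fT ST; have [N mN ->] := HM T fT ST.
  have imI (V : set (characters (subalg T))) :
      restr T @` (E `&` restr T @^-1` V) = restr T @` E `&` V.
    apply/seteqP; split => [_ [x [Ex Vx] <-]|_ [[x Ex <-] Vx]].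
      by split => //; exists x.
    by exists x.
  apply: EFin_inj; rewrite EFinD -!rE// preimage_setC !imI.
  by apply: sub_caratheodory; exact: sub_sigma_algebra.
pose D T := r T E - (r T (E `&` M) + r T (E `&` ~` M)).
have D0 T : fin_generated T -> {subset S <= T} -> D T = 0.
  by move=> fT ST; rewrite /D -rM// subrr.
have cD : D @ U --> m E - (m (E `&` M) + m (E `&` ~` M)).
  exact: cvgB (@m_cvg E) (cvgD (@m_cvg (E `&` M)) (@m_cvg (E `&` ~` M))).
apply/eqP; rewrite -subr_eq0 eq_le -oppr_ge0; apply/andP; split.
  apply: (lim_ge0 _ (cvgN cD)).
  apply: (nearU fS) => T fT ST.
  by change (0 <= - D T); rewrite D0// oppr0.
by apply: (lim_ge0 _ cD); apply: (nearU fS) => T fT ST; rewrite D0.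
Qed.

(** Openness is assumed over all algebras because the same condition is used on every [subalg T]
    whose [T] contains [b]. *)
Let m_splits_gelfand (b : A) (D : set R) :
  (forall (B : characterAlgType R) (b : B), open [set x : characters B | D (gelfand b x)]) ->
  splits m [set x | D (gelfand b x)].
Proof.
move=> oD; have [S fS bS] := fin_generated_mem b; apply: (m_splits fS) => T fT ST.
pose b' : subalg T := exist _ b (ST _ bS).
by exists [set x | D (gelfand b' x)] => //; apply: borel_open; exact: oD.
Qed.

(** The measure [nu] is compared with the family only through its upper bound by [m] on open
    cylinders. This makes the complement of each constraint null and bounds second moments by the
    values of [L]; [moments_of_squares] turns the latter into equality of first moments. *)
Lemma limit_of_tight_family :
  exists nu : {measure set (borel (characters A)) -> \bar R},
  representing_radon L
    (\bigcap_(S in [set S : subalgClosed A | fin_generated S]) (restr S @^-1` K S)) nu.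
Proof.
have [| | | | | | |nu [rnu nu1 nuG]] := @radon_extension R (characters A) m.
- exact: characters_hausdorff.
- exact: m0.
- exact: m_mono.
- exact: mU.
- apply: m_le; apply: nearU_fin => T fT.
  by case/andP: (r_itv setT fT).
- move=> C D; apply: characters_separated; first exact: m0.
  by move=> b t; apply: (m_splits_gelfand b (D := [set s | s < t])) => B c;
    exact: open_gelfand_lt.
- move=> eps /tight_mu[C [cC HC]]; exists C => //.
  apply: m_ge; apply: nearU_fin => T fT.
  rewrite -lee_fin -rE//.
  rewrite measurable_mu_extE; first exact: HC.
  apply: borel_closed; apply: compact_closed; first exact: characters_hausdorff.
  by apply: continuous_compact => //; apply: continuous_subspaceT; exact: restr_continuous.
have clKA : closed (\bigcap_(S in [set S : subalgClosed A | fin_generated S])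
    (restr S @^-1` K S)).
  apply: closed_bigI => S fS; apply: closed_comp; last exact: clK.
  by move=> x _; exact: restr_continuous.
have nullK S : fin_generated S -> nu (~` (restr S @^-1` K S)) = 0%E.
  move=> fS; apply/eqP; rewrite eq_le measure_ge0 andbT.
  have oK : open (~` K S) by apply: closed_openC; exact: clK.
  apply: le_trans (nuG _ _ _) _.
  - rewrite preimage_setC; apply: open_comp oK => x _; exact: restr_continuous.
  - apply: (m_splits fS) => T fT ST; exists (restr_sub ST @^-1` (~` K S)).
      by apply: borel_open; apply: open_comp oK => x _; exact: restr_sub_continuous.
    by rewrite restr_sub_preimage preimage_setC.
  (* For [T] above [S], a character restricting into [K T] also restricts into [K S], so the set in
     question lies over the complement of [K T], which is [mu T]-null. *)
  rewrite lee_fin; apply: m_le.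
  apply: (nearU fS) => T fT ST.
  have [[[mKT KT0] _] _] := muK fT.
  rewrite -lee_fin -[X in (_ <= X)%E]KT0; apply: r_le => //; first exact: measurableC.
  move=> x nKx KTx; apply: nKx; rewrite -(restr_sub_preimage ST).
  by apply: (@subK S T ST fS fT); exists (restr T x).
exists nu; split => //; split.
  have mKA := borel_closed clKA; split => //.
  apply/eqP; rewrite eq_le measure_ge0 andbT.
  (* The complement is a possibly uncountable union of open null sets. Inner regularity reduces it
     to compact subsets, each covered by finitely many of them. *)
  rewrite rnu.2; last exact: measurableC.
  apply: ge_ereal_sup => _ [C [cC CK] <-].
  have [W mW [CW W0]] : exists2 W : set (borel (characters A)),
      measurable W & C `<=` W /\ nu W = 0%E.
    apply: (compact_set_ind (P := fun V => exists2 W : set (borel (characters A)),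
      measurable W & V `<=` W /\ nu W = 0%E) cC).
    - by exists set0 => //; split => //; rewrite measure0.
    - move=> V V' [W mW [VW W0]] [W' mW' [VW' W0']]; exists (W `|` W').
        exact: measurableU.
      split; first exact: setUSS.
      by apply: null_set_setU.
    - move=> V V' VV' [W mW [VW W0]]; exists W => //.
      by split => //; exact: subset_trans VW.
    - move=> x /CK /existsNP[S /not_implyP[fS nKx]].
      have oW : open (~` (restr S @^-1` K S)).
        rewrite preimage_setC; apply: open_comp; last by apply: closed_openC; exact: clK.
        by move=> y _; exact: restr_continuous.
      exists (~` (restr S @^-1` K S)); first exact: open_nbhs_nbhs.
      exists (~` (restr S @^-1` K S)); first exact: borel_open.
      by split => //; exact: nullK.
  rewrite -W0; apply: le_measure; rewrite ?inE//.
  by apply: borel_closed; apply: compact_closed => //; exact: characters_hausdorff.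
apply: (@moments_of_squares _ _ R A nu id L nu1) => //.
  by move=> a; exact: gelfand_measurable.
move=> a; rewrite (_ : (\int[nu]_x _)%E = \int[nu]_x (gelfand (a ^+ 2) x)%:E)%E; last first.
  by apply: eq_integral => x _; rewrite /gelfand rmorphXn.
have sq0 (B : comAlgType R) (b : B) x : 0 <= gelfand (b ^+ 2) x.
  by rewrite /gelfand rmorphXn sqr_ge0.
(* The layers of [a ^+ 2] are open cylinders, where [nu] is at most [m]. *)
apply: integral_le_sum_layer => //; first exact: gelfand_measurable.
move=> e N e0; pose l k : set (characters A) := layer (gelfand (a ^+ 2)) e k.
have sl k : splits m (l k).
  apply: (m_splits_gelfand _ (D := [set s | k.+1%:R * e < s])) => B b.
  exact: open_gelfand_gt.
apply: (@le_trans _ _ (\sum_(k < N) e * m (l k))%:E).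
  rewrite -sumEFin; apply: lee_sum => k _; rewrite EFinM lee_wpmul2l ?lee_fin//.
    exact: ltW.
  by apply: nuG (sl k); exact: open_gelfand_gt.
have cs : (fun T => \sum_(k < N) e * r T (l k)) @ U --> \sum_(k < N) e * m (l k).
  elim: N => [|N ih].
    rewrite big_ord0 (_ : (fun T => _) = cst 0); first exact: cvg_cst.
    by apply/funext => T; rewrite big_ord0.
  rewrite big_ord_recr (_ : (fun T => _) =
     (fun T => \sum_(k < N) e * r T (l k) + e * r T (l N))); last first.
    by apply/funext => T; rewrite big_ord_recr.
  by apply: cvgD => //; apply: cvgMr; exact: (@m_cvg _).
rewrite lee_fin -subr_ge0; apply: (lim_ge0 _ (cvgB (cvg_cst _) cs)).
(* Once [T] contains [a], the layer sum is at most the [mu T]-integral of the square of [a], which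
   is [L (a ^+ 2)]. *)
have [S fS aS] := fin_generated_mem a.
apply: (nearU fS) => T fT ST.
rewrite subr_ge0 -lee_fin.
pose a' : subalg T := exist _ a (ST _ aS).
have [[_ /(_ (a' ^+ 2))[_ ea]] _] := muK fT.
rewrite (_ : L (a ^+ 2) = (L \o subalg_val T) (a' ^+ 2)); last first.
  by rewrite /= rmorphXn.
rewrite ea; apply: le_trans (sum_layer_le_integral _ _ _ N e0); last 2 first.
- exact: gelfand_measurable.
- exact: sq0.
rewrite -sumEFin; apply: lee_sum => k _; rewrite EFinM.
apply: lee_wpmul2l; first by rewrite lee_fin ltW.
apply: (@r_le T (l k) (layer (gelfand (a' ^+ 2)) e k)) => //.
exact: (measurable_layer (@gelfand_measurable _ _ (a' ^+ 2))).
Qed.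

End Prokhorov.

(** * The equivalences for cylinder measures and for Radon measures *)

Theorem theorem3p10 (R : realType) (A : characterAlgType R) (L : {scalar A})
    (K : forall S : subalgClosed A, set (characters (subalg S))) :
  L 1 = 1 ->
  (forall S : subalgClosed A, fin_generated S -> closed (K S)) ->
  (forall (S T : subalgClosed A) (ST : {subset S <= T}),
    fin_generated S -> fin_generated T -> restr_sub ST @` K T `<=` K S) ->
  ((exists mu : {measure set (g_sigma_algebraType (cylinders A)) -> \bar R},
      representing L setT mu /\
      forall S : subalgClosed A, fin_generated S ->
        supported_in mu (restr S @^-1` K S))
   <->
   (exists mu : measure_family A,
      [/\ forall S : subalgClosed A, fin_generated S ->
            representing_radon (L \o subalg_val S) (K S) (mu S),
          exact_system fin_generated mu
        & exists muL : measure_family A,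
            corresponding_system mu muL /\ thick muL]))
  /\
  ((exists nu : {measure set (borel (characters A)) -> \bar R},
      representing_radon L
        (\bigcap_(S in [set S : subalgClosed A | fin_generated S])
           (restr S @^-1` K S)) nu)
   <->
   (exists mu : measure_family A,
      (forall S : subalgClosed A, fin_generated S ->
         representing_radon (L \o subalg_val S) (K S) (mu S)) /\
      prokhorov mu)).
Proof.
move=> L1 clK subK; split; split.
- move=> [mu [rmu smu]]; have mu1 := representing_total L1 rmu.
  (* One family of marginals over all countably generated subalgebras serves both as the given
     system and as the corresponding one. *)
  have [mf mfE] := marginals (P := countably_generated) mu
    (@restr_cylinder_measurable R A).
  have mf1 T : countably_generated T -> mf T setT = 1%E.
    by move=> cT; rewrite mfE// preimage_setT.
  have rad T : countably_generated T -> radon (mf T).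
    move=> cT; have [e ge] := countably_generated_seq cT.
    exact: (radon_countably_generated ge (mf1 T cT)).
  have finc := @fin_generated_countably R A.
  exists mf; split.
  + move=> S fS; split; last exact: rad (finc S fS).
    apply: (marginal_representing rmu (restr_cylinder_measurable (finc S fS))).
    * exact: mfE (finc S fS).
    * exact: clK.
    * by have [] := smu S fS.
  + by move=> S T ST fS fT; apply: (marginal_exact mfE finc); [|exact: finc].
  + exists mf; split; last first.
      move=> T cT M mM MT; rewrite mfE//.
      rewrite (_ : _ @^-1` M = set0) ?measure0// -subset0 => x Mx.
      by rewrite -[set0 _]/(set0 (restr T x)) -MT; split => //; exists x.
    split.
    * by move=> T cT; split; [exact: rad|exact: mf1].
    * by move=> S T ST fS cT; exact: (marginal_exact mfE finc).
    * by move=> S T ST cS cT; apply: (marginal_exact (P := countably_generated) mfE).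
- move=> [mf [rmf _ [muL [[radL exfL exL] thL]]]].
  have [mu muE] := thick_system_measure exL thL.
  have finc := @fin_generated_countably R A.
  have mfE S : fin_generated S -> forall B : set (borel (characters (subalg S))),
      measurable B -> mf S B = mu (restr S @^-1` B).
    move=> fS B mB; have cS := finc S fS.
    (* Compatibility along the inclusion of [S] in itself, whose restriction map is the identity,
       identifies [mf S] with [muL S]. *)
    rewrite -(exfL S S (fun _ => id) fS cS B mB) muE// /pushforward.
    congr (muL S _); apply/seteqP; split => x; rewrite /preimage/=.
      by rewrite restr_sub_id.
    by rewrite restr_sub_id.
  have mS S : fin_generated S -> measurable_fun setT
      (restr S : g_sigma_algebraType (cylinders A) -> borel (characters (subalg S))).
    by move=> fS; exact: restr_cylinder_measurable (finc S fS).
  exists mu; split; last first.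
    move=> S fS; have [[[mK K0] _] _] := rmf S fS; split.
      exact: (preimage_measurable (mS S fS) mK).
    by rewrite preimage_setC -(mfE S fS _ (measurableC mK)).
  split; first by split; [exact: measurableT|rewrite setCT measure0].
  (* Each [a] lies in some finitely generated [S], so its integral is computed on the characters of
     [S]. *)
  move=> a; have [S fS aS] := fin_generated_mem a.
  pose b : subalg S := exist _ a aS.
  have [[_ /(_ b)[ib eb]] _] := rmf S fS.
  have mb : measurable_fun setT (EFin \o (gelfand b : borel _ -> R)).
    by apply/measurable_EFinP; exact: gelfand_measurable.
  have ia := (integrable_transfer (mS S fS) (mfE S fS) mb).1 ib.
  split; first exact: ia.
  by rewrite -(integral_transfer (mS S fS) (mfE S fS) mb ia) -eb.
- move=> [nu [rnu radnu]]; have nu1 := representing_total L1 rnu.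
  have crestr (S : subalgClosed A) :
      continuous (restr S : characters A -> characters (subalg S)).
    exact: restr_continuous.
  have mrestr (S : subalgClosed A) : True -> measurable_fun setT
      (restr S : borel (characters A) -> borel (characters (subalg S))).
    by move=> _; exact: (borel_continuous (crestr S)).
  have [mf mfE] := marginals (P := fun=> True) nu mrestr.
  exists mf; split.
    move=> S fS; split; last first.
      apply: (radon_pushforward _ _ (crestr S) (mfE S I) nu1 radnu);
        exact: characters_hausdorff.
    apply: (marginal_representing rnu (mrestr S I) (mfE S I) (clK S fS)).
    have [[mK nuK] _] := rnu.
    apply/eqP; rewrite eq_le measure_ge0 andbT -nuK; apply: le_measure; rewrite ?inE.
    + by apply: measurableC; apply: (preimage_measurable (mrestr S I));
        apply: borel_closed; exact: clK.
    + exact: measurableC.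
    + by move=> x nKx Kx; apply: nKx; exact: Kx.
  (* Inner regularity on the whole space gives one compact [C] of mass above [1 - e]; it lies in the
     preimage of each of its restrictions, which therefore have at least that mass. *)
  move=> e e0; have : ((1 - e)%:E < nu setT)%E by rewrite nu1 lte_fin gtrBl.
  rewrite radnu.2//; move=> /ereal_sup_gt[_ [C [cC _] <-] eC].
  exists C; split => // S fS.
  have mC : measurable (C : set (borel (characters A))).
    by apply: borel_closed; apply: compact_closed => //; exact: characters_hausdorff.
  have mfC : measurable (restr S @` C : set (borel (characters (subalg S)))).
    apply: borel_closed; apply: compact_closed; first exact: characters_hausdorff.
    by apply: continuous_compact => //; exact: continuous_subspaceT (crestr S).
  rewrite mfE//; apply: le_trans (ltW eC) _; apply: le_measure; rewrite ?inE//.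
    exact: (preimage_measurable (mrestr S I) mfC).
  exact: preimage_image.
- move=> [mf [rmf tmf]].
  have [U [uU tU]] := ultraFilterLemma (@fin_generated_tails_filter R A).
  exact: (limit_of_tight_family L1 clK subK rmf tmf uU tU).
Qed.
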